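(* Given an $n\times n$ matrix $A$ with entries from a totally ordered set, one can report a pseudo-saddlepoint of $A$ in $O(n\cdot 2^{\lg^* n})$ time.
   Context: Entries of $A=(a_{i,j})$ are accessed by queries and compared in constant time. A pseudo-saddlepoint of $A$ is an entry $a_{i,j}=v$ such that every row of $A$ contains an entry $\geq v$ and every column of $A$ contains an entry $\leq v$. The iterated logarithm is $\lg^* x=0$ for $x\leq 1$ and $\lg^* x=1+\lg^*(\lg x)$ for $x>1$, with $\lg$ the base-2 logarithm. *)

(* Defs.v *)
From Stdlib Require Import ZArith Reals Lra Lia.
From mathcomp Require Import all_boot all_order all_algebra.

Set Implicit Arguments.
Unset Strict Implicit.
Unset Printing Implicit Defensive.

(* The delimiter %R now stands for MathComp's [ring_scope]; Stdlib's reals are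
   used only for the iterated logarithm. *)
Delimit Scope R_scope with coqR.

(** * The iterated logarithm *)

Definition lg (x : R) : R := (ln x / ln 2)%coqR.

(* The recursion of lg^* on the reals is not structural.  [up x] bounds its
   depth, so that [lgstar] satisfies the two defining equations, proved below
   as [lgstar_le1] and [lgstar_gt1]. *)
Fixpoint lgstar_rec (fuel : nat) (x : R) : nat :=
  if fuel is f.+1 then
    if Rle_dec x 1 then 0 else (lgstar_rec f (lg x)).+1
  else 0.

Definition lgstar (x : R) : nat := lgstar_rec (Z.to_nat (up x)) x.

Lemma ln2_gt0 : (0 < ln 2)%coqR.
Proof. by rewrite -ln_1; apply: ln_increasing; lra. Qed.

Lemma INR_le_pow2 m : (INR m.+1 <= 2 ^ m)%coqR.
Proof.
elim: m => [|m IH]; first by rewrite /=; lra.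
rewrite S_INR -tech_pow_Rmult; have : (1 <= 2 ^ m)%coqR by apply: pow_R1_Rle; lra.
lra.
Qed.

Lemma lg_le m x : (1 < x)%coqR -> (x <= INR m.+1)%coqR -> (lg x <= INR m)%coqR.
Proof.
move=> x1 xm; have l2 := ln2_gt0.
apply: (Rmult_le_reg_r (ln 2)) => //.
have -> : (lg x * ln 2 = ln x)%coqR by rewrite /lg; field; lra.
rewrite -ln_pow; last lra.
have x2 : (x <= 2 ^ m)%coqR by have := INR_le_pow2 m; lra.
case: (Rle_lt_or_eq_dec _ _ x2) => [lt|->]; last exact: Rle_refl.
by apply: Rlt_le; apply: ln_increasing; lra.
Qed.

Lemma lgstar_rec_fuel f g x :
  (x <= INR f)%coqR -> (x <= INR g)%coqR -> lgstar_rec f x = lgstar_rec g x.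
Proof.
elim: f g x => [|f IH] [|g] x xf xg //=.
- by case: Rle_dec => // nx; exfalso; apply: nx; move: xf => /=; lra.
- by case: Rle_dec => // nx; exfalso; apply: nx; move: xg => /=; lra.
case: Rle_dec => // nx; congr S.
by apply: IH; apply: lg_le => //; lra.
Qed.

Lemma up_fuel x : (x <= INR (Z.to_nat (up x)))%coqR.
Proof.
have [xu _] := archimed x; case: (Z.le_gt_cases 0 (up x)) => u0.
  by rewrite INR_IZR_INZ Z2Nat.id //; lra.
have : (IZR (up x) <= 0)%coqR by apply: IZR_le; lia.
by have := pos_INR (Z.to_nat (up x)); lra.
Qed.

Lemma lgstar_le1 x : (x <= 1)%coqR -> lgstar x = 0.
Proof. by rewrite /lgstar; case: Z.to_nat => //= f; case: Rle_dec. Qed.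

Lemma lgstar_gt1 x : (1 < x)%coqR -> lgstar x = 1 + lgstar (lg x).
Proof.
rewrite /lgstar => x1; have := up_fuel x; case: Z.to_nat => [|f] /= xf; first lra.
case: Rle_dec => [x_le1 | nx1]; first lra.
rewrite add1n; congr S; apply: lgstar_rec_fuel (up_fuel _).
exact: lg_le.
Qed.

(** * Pseudo-saddlepoints *)

Definition pseudo_saddlepoint (d : Order.disp_t) (T : orderType d) (n : nat)
    (A : 'M[T]_n) (i j : 'I_n) : Prop :=
  (forall r : 'I_n, exists c : 'I_n, (A i j <= A r c)%O) /\
  (forall c : 'I_n, exists r : 'I_n, (A r c <= A i j)%O).

(** * The machine model *)

(* A random access machine with a word memory, programmed by while-programs.
   A word is a natural number below a bound [W]; an operation whose result does
   not fit makes the program get stuck.  Entries of the matrix are not words: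
   they can be used only through [TEntryLe], which queries two entries, given
   by their positions, and compares them. *)
Inductive expr : Type :=
| EConst of nat
| ELoad of expr
| EAdd of expr & expr
| ESub of expr & expr
| EMul of expr & expr
| EDiv of expr & expr.

Inductive test : Type :=
| TLe of expr & expr
| TEntryLe of expr & expr & expr & expr.

Inductive cmd : Type :=
| CSkip
| CStore of expr & expr
| CSeq of cmd & cmd
| CIf of test & cmd & cmd
| CWhile of test & cmd.

Definition memory := nat -> nat.

Definition word (W v : nat) : option nat := if v < W then Some v else None.

Fixpoint eval (W : nat) (m : memory) (e : expr) : option nat :=
  let binop op e1 e2 :=
    if (eval W m e1, eval W m e2) is (Some v1, Some v2)
    then word W (op v1 v2) else None in
  match e with
  | EConst v => word W v
  | ELoad e1 => if eval W m e1 is Some a then word W (m a) else None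
  | EAdd e1 e2 => binop addn e1 e2
  | ESub e1 e2 => binop subn e1 e2
  | EMul e1 e2 => binop muln e1 e2
  | EDiv e1 e2 => binop divn e1 e2
  end.

(* Indices outside of the matrix make the query, hence the program, get stuck. *)
Definition query (T : Type) (n : nat) (A : 'M[T]_n) (i j : option nat) :
    option T :=
  if (obind insub i, obind insub j) is (Some i', Some j')
  then Some (A i' j') else None.

Definition eval_test (W : nat) (d : Order.disp_t) (T : orderType d) (n : nat)
    (A : 'M[T]_n) (m : memory) (b : test) : option bool :=
  match b with
  | TLe e1 e2 =>
      if (eval W m e1, eval W m e2) is (Some v1, Some v2)
      then Some (v1 <= v2) else None
  | TEntryLe i j k l =>
      if (query A (eval W m i) (eval W m j), query A (eval W m k) (eval W m l))
        is (Some x, Some y)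
      then Some (x <= y)%O else None
  end.

(* [exec W A c m m' t]: from memory [m], the command [c] halts with memory [m']
   in time [t].  Each store and each evaluation of a test takes one time unit;
   as the programs considered do not depend on the input, the number of
   operations in their expressions only contributes a constant factor. *)
Inductive exec (W : nat) (d : Order.disp_t) (T : orderType d) (n : nat)
    (A : 'M[T]_n) : cmd -> memory -> memory -> nat -> Prop :=
| ExecSkip m : exec W A CSkip m m 0
| ExecStore e1 e2 m a v :
    eval W m e1 = Some a -> eval W m e2 = Some v ->
    exec W A (CStore e1 e2) m [eta m with a |-> v] 1
| ExecSeq c1 c2 m1 m2 m3 t1 t2 :
    exec W A c1 m1 m2 t1 -> exec W A c2 m2 m3 t2 ->
    exec W A (CSeq c1 c2) m1 m3 (t1 + t2)
| ExecIf b c1 c2 m m' t r :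
    eval_test W A m b = Some r -> exec W A (if r then c1 else c2) m m' t ->
    exec W A (CIf b c1 c2) m m' t.+1
| ExecWhileFalse b c m :
    eval_test W A m b = Some false ->
    exec W A (CWhile b c) m m 1
| ExecWhileTrue b c m1 m2 m3 t1 t2 :
    eval_test W A m1 b = Some true ->
    exec W A c m1 m2 t1 -> exec W A (CWhile b c) m2 m3 t2 ->
    exec W A (CWhile b c) m1 m3 (t1 + t2).+1.

(* The size of the matrix is given in cell 0; all the other cells hold 0. *)
Definition init_memory (n : nat) : memory := fun a => if a == 0 then n else 0.

(* On the matrix [A], the program [c] halts within time [t] and reports a
   pseudo-saddlepoint by leaving its row and column in cells 0 and 1. *)
Definition reports_pseudo_saddlepoint (W : nat) (c : cmd) (d : Order.disp_t)
    (T : orderType d) (n : nat) (A : 'M[T]_n) (t : nat) : Prop :=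
  exists (m : memory) (t' : nat) (i j : 'I_n),
    [/\ exec W A c (init_memory n) m t', t' <= t,
        m 0 = i, m 1 = j & pseudo_saddlepoint A i j].

(* Main.v *)
(* For a pseudo-saddlepoint it suffices to find a position whose value [v] is at
   most some entry of each row and at least some entry of each column.  Cut the
   rows and the columns of an [n] x [n] matrix into [N] groups of [m] = lg [n]
   elements.  Give each row group a key below some entry of each of its rows, and
   each column group a key above some entry of each of its columns; at first both
   keys of the group [g] are a pseudo-saddlepoint of the diagonal block [(g, g)].
   As long as the least row key, at [r], is below the greatest column key, at [c],
   a pseudo-saddlepoint [w] of the block [(r, c)] raises the key of [r] to
   [max rho w] and lowers that of [c] to [min gam w].  A matching between row and
   column groups of equal keys, outside of which all groups are settled, loses one
   pair at each such step, so that [N - 1] steps suffice.  With tournament trees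
   this gives T(n) <= (2N - 1) T(lg n) + O(n), where N = n / lg n up to rounding,
   hence T(n) = O(n 2^(lg* n)).  The recursion is run by a single loop with an
   explicit stack of frames. *)
Require Import Defs.
From Stdlib Require Import Reals Lra.
From mathcomp Require Import all_boot all_order all_algebra.
From mathcomp Require Import zify.

Set Implicit Arguments.
Unset Strict Implicit.
Unset Printing Implicit Defensive.
Import Order.TTheory.

(** * Total correctness of programs *)

Fixpoint val (m : memory) (e : expr) : nat :=
  match e with
  | EConst v => v
  | ELoad e1 => m (val m e1)
  | EAdd e1 e2 => val m e1 + val m e2
  | ESub e1 e2 => val m e1 - val m e2
  | EMul e1 e2 => val m e1 * val m e2
  | EDiv e1 e2 => val m e1 %/ val m e2
  end.

(** [B ^ deg e] bounds the value of [e] once all memory cells and all constants are below [B]; the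
    exponent 12 in [small] matches the hypothesis [B ^ 12 <= W]. *)
Fixpoint deg (e : expr) : nat :=
  match e with
  | EConst _ | ELoad _ => 1
  | EAdd e1 e2 => (maxn (deg e1) (deg e2)).+1
  | EMul e1 e2 => deg e1 + deg e2
  | ESub e1 _ | EDiv e1 _ => deg e1
  end.

Fixpoint small (e : expr) : bool :=
  match e with
  | EConst v => v <= 64
  | ELoad e1 => small e1
  | EAdd e1 e2 | ESub e1 e2 | EMul e1 e2 | EDiv e1 e2 =>
      [&& small e1, small e2 & deg e <= 12]
  end.

Definition upd (m : memory) (a v : nat) : memory := [eta m with a |-> v].
Arguments upd : simpl never.

Lemma upd_same m a v x : x = a -> upd m a v x = v.
Proof. by move=> ->; rewrite /upd /= eqxx. Qed.

Lemma upd_other m a v x : x <> a -> upd m a v x = m x.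
Proof. by rewrite /upd /= => /eqP/negbTE ->. Qed.

Section Runs.

Variables (n0 : nat) (d : Order.disp_t) (T : orderType d) (A : 'M[T]_n0.+1).
Variables (B W : nat).
Hypotheses (B64 : 64 < B) (BW : B ^ 12 <= W).

(* [words_lt] is kept invariant by every store, so that the overflow checks of
   [eval] reduce to the syntactic condition [small]. *)
Definition words_lt (m : memory) := forall x, m x < B.

Lemma eval_small m e : words_lt m -> small e ->
  eval W m e = Some (val m e) /\ val m e < B ^ deg e.
Proof.
move=> bm.
have B1 : 0 < B by lia.
have wordE v k : v < B ^ k -> k <= 12 -> word W v = Some v.
  move=> vB k12; rewrite /word; case: ltnP => // Wv.
  by have := leq_pexp2l B1 k12; lia.
elim: e => [v|e IH|e1 IH1 e2 IH2|e1 IH1 e2 IH2|e1 IH1 e2 IH2|e1 IH1 e2 IH2] /=.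
- move=> v64; have vB : v < B ^ 1 by rewrite expn1; apply: leq_ltn_trans B64.
  by rewrite (wordE _ _ vB).
- move=> /IH[-> _]; have mB : m (val m e) < B ^ 1 by rewrite expn1; apply: bm.
  by rewrite (wordE _ _ mB).
- move=> /and3P[/IH1[-> b1] /IH2[-> b2] dg].
  have : val m e1 + val m e2 < B ^ (maxn (deg e1) (deg e2)).+1.
    have := leq_pexp2l B1 (leq_maxl (deg e1) (deg e2)).
    have := leq_pexp2l B1 (leq_maxr (deg e1) (deg e2)).
    by rewrite expnS; nia.
  by move=> b; rewrite (wordE _ _ b).
- move=> /and3P[/IH1[-> b1] /IH2[-> b2] dg].
  have b : val m e1 - val m e2 < B ^ deg e1 by lia.
  by rewrite (wordE _ _ b).
- move=> /and3P[/IH1[-> b1] /IH2[-> b2] dg].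
  have b : val m e1 * val m e2 < B ^ (deg e1 + deg e2) by rewrite expnD ltn_mul.
  by rewrite (wordE _ _ b).
- move=> /and3P[/IH1[-> b1] /IH2[-> b2] dg].
  have b : val m e1 %/ val m e2 < B ^ deg e1.
    by have := leq_div (val m e1) (val m e2); lia.
  by rewrite (wordE _ _ b).
Qed.

(** A weakest precondition with a time budget: [Q] may itself be a [runs] statement about the rest
    of the program, so that programs are executed symbolically from left to right. *)
Definition runs (c : cmd) (m : memory) (k : nat) (Q : memory -> Prop) : Prop :=
  words_lt m ->
  exists (m' : memory) (t : nat), [/\ exec W A c m m' t, t <= k, words_lt m' & Q m'].

Lemma runs_weaken c m k k' (Q Q' : memory -> Prop) :
  k <= k' -> (forall m', Q m' -> Q' m') -> runs c m k Q -> runs c m k' Q'.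
Proof.
move=> kk QQ r bm; have [m' [t [ex tk bm' Qm]]] := r bm.
by exists m', t; split=> //; [lia | exact: QQ].
Qed.

(** Gives access to the implicit invariant where a stored value has no other bound, as for the saved
    parent frame. *)
Lemma runs_bounded c m k Q : (words_lt m -> runs c m k Q) -> runs c m k Q.
Proof. by move=> r bm; exact: (r bm bm). Qed.

Lemma runs_skip m (Q : memory -> Prop) : Q m -> runs CSkip m 0 Q.
Proof. by move=> Qm bm; exists m, 0; split=> //; constructor. Qed.

Lemma runs_store e1 e2 m (Q : memory -> Prop) :
  small e1 -> small e2 -> val m e2 < B ->
  Q (upd m (val m e1) (val m e2)) -> runs (CStore e1 e2) m 1 Q.
Proof.
move=> s1 s2 vB Qm bm; exists (upd m (val m e1) (val m e2)), 1; split=> //.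
  by apply: ExecStore; [have [] := eval_small bm s1 | have [] := eval_small bm s2].
by move=> x; rewrite /upd /=; case: ifP.
Qed.

Lemma runs_seq c1 c2 m k1 k2 Q :
  runs c1 m k1 (fun m' => runs c2 m' k2 Q) -> runs (CSeq c1 c2) m (k1 + k2) Q.
Proof.
move=> r1 bm; have [m1 [t1 [ex1 tk1 bm1 r2]]] := r1 bm.
have [m2 [t2 [ex2 tk2 bm2 Qm]]] := r2 bm1.
by exists m2, (t1 + t2); split=> //; [exact: ExecSeq ex1 ex2 | lia].
Qed.

Lemma runs_seq_le k1 c1 c2 m k Q :
  k1 <= k -> runs c1 m k1 (fun m' => runs c2 m' (k - k1) Q) -> runs (CSeq c1 c2) m k Q.
Proof. by move=> k1k /runs_seq; rewrite subnKC. Qed.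

Lemma runs_store_seq e1 e2 c m k Q :
  small e1 -> small e2 -> 0 < k -> val m e2 < B ->
  runs c (upd m (val m e1) (val m e2)) (k - 1) Q -> runs (CSeq (CStore e1 e2) c) m k Q.
Proof. by move=> s1 s2 k0 vB r; apply: (@runs_seq_le 1) => //; apply: runs_store. Qed.

Lemma eval_test_le m e1 e2 : words_lt m -> small e1 -> small e2 ->
  eval_test W A m (TLe e1 e2) = Some (val m e1 <= val m e2).
Proof.
by move=> bm s1 s2 /=; have [-> _] := eval_small bm s1; have [-> _] := eval_small bm s2.
Qed.

(** Made total through [inord], so that positions read from memory need no dependent bounds; those
    bounds are carried separately. *)
Definition entry (i j : nat) : T := A (inord i) (inord j).

Lemma query_entry i j : i < n0.+1 -> j < n0.+1 -> query A (Some i) (Some j) = Some (entry i j).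
Proof.
move=> ilt jlt; rewrite /query /= (insubT (fun x => x < n0.+1) ilt).
rewrite (insubT (fun x => x < n0.+1) jlt) /entry.
congr (Some (A _ _)); apply: val_inj; rewrite /= inordK //.
Qed.

Lemma eval_test_entry m i j k l : words_lt m ->
  [&& small i, small j, small k & small l] ->
  [&& val m i < n0.+1, val m j < n0.+1, val m k < n0.+1 & val m l < n0.+1] ->
  eval_test W A m (TEntryLe i j k l) =
  Some (entry (val m i) (val m j) <= entry (val m k) (val m l))%O.
Proof.
move=> bm /and4P[si sj sk sl] /and4P[li lj lk ll] /=.
have [-> _] := eval_small bm si; have [-> _] := eval_small bm sj.
have [-> _] := eval_small bm sk; have [-> _] := eval_small bm sl.
by rewrite !query_entry.
Qed.

Lemma runs_if_le e1 e2 c1 c2 m k Q :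
  small e1 -> small e2 ->
  (val m e1 <= val m e2 -> runs c1 m k Q) ->
  (val m e2 < val m e1 -> runs c2 m k Q) ->
  runs (CIf (TLe e1 e2) c1 c2) m k.+1 Q.
Proof.
move=> s1 s2 r1 r2 bm; have ev := eval_test_le bm s1 s2.
case: (leqP (val m e1) (val m e2)) ev => le ev.
  have [m' [t [ex tk bm' Qm]]] := r1 le bm.
  by exists m', t.+1; split=> //; exact: ExecIf ev ex.
have [m' [t [ex tk bm' Qm]]] := r2 le bm.
by exists m', t.+1; split=> //; exact: ExecIf ev ex.
Qed.

Lemma runs_if_entry i j k l c1 c2 m h Q :
  [&& small i, small j, small k & small l] ->
  [&& val m i < n0.+1, val m j < n0.+1, val m k < n0.+1 & val m l < n0.+1] ->
  ((entry (val m i) (val m j) <= entry (val m k) (val m l))%O -> runs c1 m h Q) ->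
  ((entry (val m k) (val m l) < entry (val m i) (val m j))%O -> runs c2 m h Q) ->
  runs (CIf (TEntryLe i j k l) c1 c2) m h.+1 Q.
Proof.
move=> sm lt r1 r2 bm; have ev := eval_test_entry bm sm lt.
case: leP ev => le ev.
  have [m' [t [ex tk bm' Qm]]] := r1 le bm.
  by exists m', t.+1; split=> //; exact: ExecIf ev ex.
have [m' [t [ex tk bm' Qm]]] := r2 le bm.
by exists m', t.+1; split=> //; exact: ExecIf ev ex.
Qed.

Lemma runs_while_false e1 e2 c m (Q : memory -> Prop) :
  small e1 -> small e2 -> val m e2 < val m e1 -> Q m ->
  runs (CWhile (TLe e1 e2) c) m 1 Q.
Proof.
move=> s1 s2 lt Qm bm; exists m, 1; split=> //.
by apply: ExecWhileFalse; rewrite eval_test_le // leqNgt lt.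
Qed.

Lemma runs_while_true e1 e2 c m k1 k2 Q :
  small e1 -> small e2 -> val m e1 <= val m e2 ->
  runs c m k1 (fun m' => runs (CWhile (TLe e1 e2) c) m' k2 Q) ->
  runs (CWhile (TLe e1 e2) c) m (k1 + k2).+1 Q.
Proof.
move=> s1 s2 le r1 bm; have [m1 [t1 [ex1 tk1 bm1 r2]]] := r1 bm.
have [m2 [t2 [ex2 tk2 bm2 Qm]]] := r2 bm1.
exists m2, (t1 + t2).+1; split=> //; last lia.
by apply: ExecWhileTrue ex1 ex2; rewrite eval_test_le // le.
Qed.

End Runs.

(** * Tournament trees *)

Section Tournament.

Variables (U : Type) (le : rel U) (N : nat).
Hypotheses (le_refl : reflexive le) (le_tr : transitive le).

(* Node [j] has the children [2j] and [2j+1]; the leaves are the nodes from [N]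
   to [2N-1], and [t j] is the leaf winning at node [j]. *)
Definition node_ok (t : nat -> nat) (K : nat -> U) (j : nat) : bool :=
  [&& (t j == t (2 * j)) || (t j == t (2 * j + 1)),
      le (K (t j)) (K (t (2 * j))) & le (K (t j)) (K (t (2 * j + 1)))].

Definition leaves_ok (t : nat -> nat) : Prop := forall l, N <= l < 2 * N -> t l = l.

(** [P] is a set of nodes closed under children: while a tree is being built or repaired, only some
    nodes are correct. The induction is on [2 * N - j], as children have larger indices. *)
Lemma winner_leaf (P : nat -> Prop) t K j :
  (forall i, P i -> P (2 * i) /\ P (2 * i + 1)) ->
  (forall i, 1 <= i < N -> P i -> node_ok t K i) -> leaves_ok t ->
  1 <= j < 2 * N -> P j -> N <= t j < 2 * N.
Proof.
move=> Pch ok lv.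
elim/ltn_ind: {j}(2 * N - j) {-2}j (erefl (2 * N - j)) => u IH j ju jlt Pj.
case: (leqP N j) => Nj; first by rewrite lv; lia.
have jN : 1 <= j < N by lia.
have [P0 P1] := Pch _ Pj.
have /and3P[/orP[/eqP->|/eqP->] _ _] := ok j jN Pj.
  by apply: (IH (2 * N - 2 * j)) => //; lia.
by apply: (IH (2 * N - (2 * j + 1))) => //; lia.
Qed.

Lemma root_best t K j :
  (forall i, 1 <= i < N -> node_ok t K i) -> 1 <= j < 2 * N ->
  le (K (t 1)) (K (t j)).
Proof.
move=> ok; elim/ltn_ind: j => j IH jlt.
case: (ltngtP j 1) => [||->//]; first lia.
move=> j1; have jd := divn_eq j 2; have jm := ltn_pmod j (isT : 0 < 2).
have iN : 1 <= j %/ 2 < N by lia.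
apply: (le_tr (y := K (t (j %/ 2)))); first by apply: IH; lia.
have /and3P[_ l0 l1] := ok _ iN.
have [e|e] : j = 2 * (j %/ 2) \/ j = 2 * (j %/ 2) + 1 by lia.
  by rewrite {2}e.
by rewrite {2}e.
Qed.

(** A leaf can win only on its path to the root, whose nodes are the quotients [l %/ 2 ^ h]. *)
Lemma winner_ancestor t K j l :
  (forall i, 1 <= i < N -> node_ok t K i) -> leaves_ok t ->
  1 <= j < 2 * N -> t j = l -> exists h, j = l %/ 2 ^ h.
Proof.
move=> ok lv.
elim/ltn_ind: {j}(2 * N - j) {-2}j (erefl (2 * N - j)) => u IH j ju jlt tj.
case: (leqP N j) => Nj; first by exists 0; rewrite divn1 -tj lv; lia.
have jN : 1 <= j < N by lia.
have /and3P[/orP[/eqP e|/eqP e] _ _] := ok j jN.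
  have [//|||h jh] := IH (2 * N - 2 * j) _ (2 * j) erefl; [lia|lia|by rewrite -e|].
  by exists h.+1; rewrite expnSr divnMA -jh mulKn.
have [//|||h jh] := IH (2 * N - (2 * j + 1)) _ (2 * j + 1) erefl; [lia|lia|by rewrite -e|].
by exists h.+1; rewrite expnSr divnMA -jh; lia.
Qed.

Lemma node_ok_congr t t' K K' j :
  t' j = t j -> t' (2 * j) = t (2 * j) -> t' (2 * j + 1) = t (2 * j + 1) ->
  K' (t j) = K (t j) -> K' (t (2 * j)) = K (t (2 * j)) ->
  K' (t (2 * j + 1)) = K (t (2 * j + 1)) ->
  node_ok t' K' j = node_ok t K j.
Proof. by rewrite /node_ok => -> -> -> -> -> ->. Qed.

(** A new key at [l] can only disturb nodes where [l] wins at the node or at one of its children. By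
    [winner_ancestor] these lie on the path from [l %/ 2] to the root. *)
Lemma node_ok_key_update t K K' l j :
  (forall i, 1 <= i < N -> node_ok t K i) -> leaves_ok t ->
  (forall x, N <= x < 2 * N -> x <> l -> K' x = K x) -> N <= l ->
  1 <= j < N -> (forall h, j <> l %/ 2 %/ 2 ^ h) -> node_ok t K' j.
Proof.
move=> ok lv KK Nl jN na.
have far i : 1 <= i < 2 * N -> [\/ i = j, i = 2 * j | i = 2 * j + 1] -> K' (t i) = K (t i).
  move=> iN ij; apply: KK.
    by apply: (@winner_leaf (fun=> True) t K) => // x xN _; apply: ok.
  move=> /(winner_ancestor ok lv iN)[h ih].
  have e : l %/ 2 %/ 2 ^ h = i %/ 2 by rewrite ih -!divnMA mulnC.
  have e' : i %/ 2 %/ 2 = l %/ 2 %/ 2 ^ h.+1 by rewrite ih -!divnMA expnSr; congr (_ %/ _); lia.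
  case: ij => ij.
  - case: h ih e e' => [|h] ih e e'.
      by move: ih; rewrite divn1; lia.
    by apply: (na h); rewrite -ij ih -divnMA expnS.
  - by apply: (na h); rewrite e ij mulKn.
  - by apply: (na h); rewrite e ij; lia.
rewrite (@node_ok_congr t t K K') ?ok ?far //; try lia.
- by constructor 1.
- by constructor 2.
- by constructor 3.
Qed.

End Tournament.

(** * Narrowing the keys *)

Section Matching.

Variables (d : Order.disp_t) (T : orderType d) (N : nat).
Implicit Types rho gam : nat -> T.

(* [rho r] is a value below some entry of each row of the row group [r], and
   [gam c] a value above some entry of each column of the column group [c]. *)
Definition crossed rho gam : Prop :=
  forall r c, r < N -> c < N -> (gam c <= rho r)%O.

(* Groups outside of the matching are settled: their keys already allow every
   value between the smallest and the largest matched key. *)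
Definition matching rho gam (M : seq (nat * nat)) : Prop :=
  [/\ uniq (unzip1 M), uniq (unzip2 M),
      forall p, p \in M -> [/\ p.1 < N, p.2 < N & rho p.1 = gam p.2],
      forall r p, r < N -> r \notin unzip1 M -> p \in M -> (rho p.1 <= rho r)%O &
      forall c p, c < N -> c \notin unzip2 M -> p \in M -> (gam c <= gam p.2)%O].

Definition narrowed rho gam (k : nat) : Prop :=
  crossed rho gam \/ exists2 M, size M = k & matching rho gam M.

(** With a single pair left, its common key separates all column keys from all row keys. *)
Lemma narrowed1 rho gam : narrowed rho gam 1 -> crossed rho gam.
Proof.
case=> // -[[|[r0 c0] [|//]] //= _ [_ _ rng lo hi]] r c rN cN.
have m0 : (r0, c0) \in [:: (r0, c0)] by rewrite inE.
have [_ _ /= e] := rng _ m0.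
have h1 : (rho r0 <= rho r)%O.
  by have [->//|ne] := eqVneq r r0; apply: (lo _ _ rN _ m0); rewrite /= inE.
have h2 : (gam c <= gam c0)%O.
  by have [->//|ne] := eqVneq c c0; apply: (hi _ _ cN _ m0); rewrite /= inE.
by apply: le_trans h2 _; rewrite -e.
Qed.

Lemma matching_perm rho gam M M' :
  perm_eq M M' -> matching rho gam M -> matching rho gam M'.
Proof.
move=> pM [u1 u2 rng lo hi].
have p1 := perm_map fst pM; have p2 := perm_map snd pM.
split.
- by rewrite -(perm_uniq p1).
- by rewrite -(perm_uniq p2).
- by move=> p; rewrite -(perm_mem pM); apply: rng.
- by move=> r p rN; rewrite -(perm_mem pM) -(perm_mem p1); apply: lo.
- by move=> c p cN; rewrite -(perm_mem pM) -(perm_mem p2); apply: hi.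
Qed.

(* If [(r, c2)] and [(r2, c)] are matched, they are replaced by one pair: [(r2, c)]
   when [w] is at least all keys, [(r, c2)] when it is at most all keys, and
   [(r, c)], both of whose keys become [w], otherwise. *)
Lemma narrowed_step rho gam rho' gam' r c w k :
  r < N -> c < N ->
  (forall x, x < N -> (rho r <= rho x)%O) -> (forall x, x < N -> (gam x <= gam c)%O) ->
  (forall x, x < N -> x <> r -> rho' x = rho x) ->
  (forall x, x < N -> x <> c -> gam' x = gam x) ->
  rho' r = Order.max (rho r) w -> gam' c = Order.min (gam c) w ->
  narrowed rho gam k.+1 -> narrowed rho' gam' k.
Proof.
move=> rN cN rmin cmax rho'E gam'E rho'r gam'c.
(* Row keys only increase and column keys only decrease. *)
have mono : crossed rho gam -> crossed rho' gam'.
  move=> cr x y xN yN.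
  have h1 : (rho x <= rho' x)%O.
    have [->|/eqP ne] := eqVneq x r; last by rewrite rho'E.
    by rewrite rho'r le_max lexx.
  have h2 : (gam' y <= gam y)%O.
    have [->|/eqP ne] := eqVneq y c; last by rewrite gam'E.
    by rewrite gam'c ge_min lexx.
  by apply: le_trans h2 (le_trans (cr x y xN yN) h1).
case=> [/mono|]; first by left.
move=> [M sM mM]; have [u1 u2 rng lo hi] := mM.
have [cr|lt] := leP (gam c) (rho r).
  left; apply: mono => x y xN yN.
  by apply: le_trans (cmax y yN) (le_trans cr (rmin x xN)).
right.
have [p0 p0M] : exists p, p \in M.
  by case: (M) sM => // p M' _; exists p; rewrite inE eqxx.
(* If [c] were unmatched, [gam c] would be at most every matched key. Then [rho r], being a matched
   key or at least one of them, could not be below [gam c]. *)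
have cM : c \in unzip2 M.
  apply: contraT => cM.
  have [_ _ e0] := rng _ p0M; have h := hi _ _ cN cM p0M.
  have [rM|rM] := boolP (r \in unzip1 M).
    have /mapP[p pM rp] := rM; have [_ _ e] := rng _ pM.
    by have := hi _ _ cN cM pM; rewrite -e -rp leNgt lt.
  by have := lo _ _ rN rM p0M; rewrite e0 leNgt (lt_le_trans lt h).
have /mapP[[r2 c'] cp /= ec] := cM; rewrite -{c'}ec in cp.
have [/= r2N _ er2] := rng _ cp.
have rM : r \in unzip1 M.
  apply: contraT => rM.
  by have := lo _ _ rN rM cp; rewrite /= er2 leNgt lt.
have /mapP[[r' c2] rp /= er] := rM; rewrite -{r'}er in rp.
have [/= _ c2N erc2] := rng _ rp.
have r2r : r2 <> r by move=> e; move: lt; rewrite -er2 e ltxx.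
have c2c : c2 <> c by move=> e; move: lt; rewrite erc2 e ltxx.
have pM1 := perm_to_rem cp.
have rp1 : (r, c2) \in rem (r2, c) M.
  move: rp; rewrite (perm_mem pM1) inE => /orP[/eqP[/esym]|//].
  by move=> /r2r.
have [M0 pM2] : exists M0, perm_eq (rem (r2, c) M) ((r, c2) :: M0).
  by exists (rem (r, c2) (rem (r2, c) M)); apply: perm_to_rem.
have pM : perm_eq M [:: (r2, c), (r, c2) & M0] by apply: perm_trans pM1 _; rewrite perm_cons.
have {mM u1 u2 rng lo hi} [/= u1 u2 rng lo hi] := matching_perm pM mM.
have sM0 : (size M0).+1 = k by move: sM; rewrite (perm_size pM) /= => -[].
move: u1 u2; rewrite !inE !negb_or -!andbA.
move=> /and4P[_ r2M rM0 u1] /and4P[_ cM0 c2M u2].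
have rng0 p : p \in M0 -> [/\ p.1 < N, p.2 < N & rho p.1 = gam p.2].
  by move=> pM0; apply: rng; rewrite !inE pM0 !orbT.
have neqr p : p \in M0 -> p.1 <> r.
  by move=> pM0 e; move: rM0; rewrite -e map_f.
have neqc p : p \in M0 -> p.2 <> c.
  by move=> pM0 e; move: cM0; rewrite -e map_f.
have rhoM p : p \in M0 -> rho' p.1 = rho p.1.
  by move=> pM0; have [pN _ _] := rng0 _ pM0; apply: rho'E pN (neqr _ pM0).
have gamM p : p \in M0 -> gam' p.2 = gam p.2.
  by move=> pM0; have [_ pN _] := rng0 _ pM0; apply: gam'E pN (neqc _ pM0).
have keyhi p : p \in M0 -> (rho p.1 <= gam c)%O.
  by move=> pM0; have [_ pN ->] := rng0 _ pM0; apply: cmax.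
have keylo p : p \in M0 -> (rho r <= gam p.2)%O.
  by move=> pM0; have [pN _ <-] := rng0 _ pM0; apply: rmin.
have r2lo : rho' r2 = gam c by rewrite rho'E.
have c2hi : gam' c2 = rho r by rewrite gam'E.
(* These four facts cover the groups that may leave the matching: [r2] is settled since its key is
   the greatest column key [gam c], and [c2] since its key is the least row key [rho r]. *)
have lo0 x p : x < N -> x <> r -> x \notin unzip1 M0 -> p \in M0 -> (rho p.1 <= rho' x)%O.
  move=> xN xr xM pM0; rewrite rho'E //.
  have [->|xr2] := eqVneq x r2; first by rewrite er2; apply: keyhi.
  apply: lo => //; last by rewrite !inE pM0 !orbT.
  by rewrite !inE !negb_or xr2 xM andbT; apply/eqP.
have lox x : x < N -> x <> r -> x \notin unzip1 M0 -> (gam c <= rho' x)%O.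
  move=> xN xr xM; rewrite rho'E //.
  have [->|xr2] := eqVneq x r2; first by rewrite er2.
  rewrite -er2; apply: (lo x (r2, c)) => //; last by rewrite inE eqxx.
  by rewrite !inE !negb_or xr2 xM andbT; apply/eqP.
have hi0 x p : x < N -> x <> c -> x \notin unzip2 M0 -> p \in M0 -> (gam' x <= gam p.2)%O.
  move=> xN xr xM pM0; rewrite gam'E //.
  have [->|xr2] := eqVneq x c2; first by rewrite -erc2; apply: keylo.
  apply: hi => //; last by rewrite !inE pM0 !orbT.
  by rewrite !inE !negb_or xr2 xM !andbT; apply/eqP.
have hix x : x < N -> x <> c -> x \notin unzip2 M0 -> (gam' x <= rho r)%O.
  move=> xN xr xM; rewrite gam'E //.
  have [->|xr2] := eqVneq x c2; first by rewrite -erc2.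
  rewrite erc2; apply: (hi x (r, c2)) => //; last by rewrite !inE eqxx orbT.
  by rewrite !inE !negb_or xr2 xM !andbT; apply/eqP.
have [wc|wc] := leP (gam c) w.
  have rw : rho' r = w by rewrite rho'r max_r // (le_trans (ltW lt)).
  have cw : gam' c = gam c by rewrite gam'c min_l.
  exists ((r2, c) :: M0) => //; split=> /=.
  - by rewrite r2M u1.
  - by rewrite cM0 u2.
  - move=> p; rewrite inE => /orP[/eqP->/=|pM0]; first by rewrite r2lo cw.
    by rewrite rhoM // gamM //; apply: rng0.
  - move=> x p xN; rewrite inE negb_or => /andP[xr2 xM].
    have [->|/eqP xr] := eqVneq x r.
      by rewrite inE rw => /orP[/eqP->/=|pM0]; rewrite ?r2lo // rhoM // (le_trans (keyhi _ pM0)).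
    by rewrite inE => /orP[/eqP->/=|pM0]; [rewrite r2lo; apply: lox|rewrite rhoM //; apply: lo0].
  - move=> x p xN; rewrite inE negb_or => /andP[/eqP xc xM].
    rewrite inE => /orP[/eqP->/=|pM0]; last by rewrite gamM //; apply: hi0.
    by rewrite cw gam'E // cmax.
have [wr|wr] := leP w (rho r).
  have rw : rho' r = rho r by rewrite rho'r max_l.
  have cw : gam' c = w by rewrite gam'c min_r // ltW.
  exists ((r, c2) :: M0) => //; split=> /=.
  - by rewrite rM0 u1.
  - by rewrite c2M u2.
  - move=> p; rewrite inE => /orP[/eqP->/=|pM0]; first by rewrite c2hi rw.
    by rewrite rhoM // gamM //; apply: rng0.
  - move=> x p xN; rewrite inE negb_or => /andP[/eqP xr xM].
    rewrite inE => /orP[/eqP->/=|pM0]; last by rewrite rhoM //; apply: lo0.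
    by rewrite rw rho'E // rmin.
  - move=> x p xN; rewrite inE negb_or => /andP[xc2 xM].
    have [->|/eqP xc] := eqVneq x c.
      rewrite inE cw => /orP[/eqP->/=|pM0]; first by rewrite c2hi.
      by rewrite gamM // (le_trans wr) // keylo.
    by rewrite inE => /orP[/eqP->/=|pM0]; [rewrite c2hi; apply: hix|rewrite gamM //; apply: hi0].
have rw : rho' r = w by rewrite rho'r max_r // ltW.
have cw : gam' c = w by rewrite gam'c min_r // ltW.
exists ((r, c) :: M0) => //; split=> /=.
- by rewrite rM0 u1.
- by rewrite cM0 u2.
- move=> p; rewrite inE => /orP[/eqP->/=|pM0]; first by rewrite rw cw.
  by rewrite rhoM // gamM //; apply: rng0.
- move=> x p xN; rewrite inE negb_or => /andP[/eqP xr xM].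
  rewrite inE => /orP[/eqP->/=|pM0]; last by rewrite rhoM //; apply: lo0.
  by rewrite rw (le_trans (ltW wc)) //; apply: lox.
- move=> x p xN; rewrite inE negb_or => /andP[/eqP xc xM].
  rewrite inE => /orP[/eqP->/=|pM0]; last by rewrite gamM //; apply: hi0.
  by rewrite cw (le_trans _ (ltW wr)) //; apply: hix.
Qed.

Lemma narrowed_init rho gam : (forall g, g < N -> rho g = gam g) -> narrowed rho gam N.
Proof.
move=> e; right; exists [seq (g, g) | g <- iota 0 N]; first by rewrite size_map size_iota.
have m1 : unzip1 [seq (g, g) | g <- iota 0 N] = iota 0 N by rewrite /unzip1 -map_comp map_id.
have m2 : unzip2 [seq (g, g) | g <- iota 0 N] = iota 0 N by rewrite /unzip2 -map_comp map_id.
split; rewrite ?m1 ?m2 ?iota_uniq //.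
- by move=> p /mapP[g]; rewrite mem_iota add0n => /andP[_ gN] -> /=; rewrite e.
- by move=> r p rN; rewrite mem_iota add0n rN.
- by move=> r p rN; rewrite mem_iota add0n rN.
Qed.

Lemma narrowed_congr rho gam rho' gam' k :
  (forall g, g < N -> rho' g = rho g) -> (forall g, g < N -> gam' g = gam g) ->
  narrowed rho gam k -> narrowed rho' gam' k.
Proof.
move=> er eg [cr|[M sM [u1 u2 rng lo hi]]].
  by left=> r c rN cN; rewrite er // eg //; apply: cr.
right; exists M => //; split=> //.
- by move=> p pM; have [p1 p2 e] := rng _ pM; rewrite er // eg.
- by move=> r p rN rM pM; have [p1 p2 e] := rng _ pM; rewrite !er //; apply: lo.
- by move=> c p cN cM pM; have [p1 p2 e] := rng _ pM; rewrite !eg //; apply: hi.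
Qed.

End Matching.

(** * The recurrence *)

Definition ngroups (s m : nat) : nat := (s + m - 1) %/ m.

(** [f] is fuel, and [f >= s] is enough. The factor counts [N] diagonal calls and [N - 1] narrowing
    calls; [C * s] pays for the frame itself. *)
Fixpoint cost (C f s : nat) : nat :=
  if f is f'.+1 then
    if s <= 1 then C
    else let m := trunc_log 2 s in
         (2 * ngroups s m - 1) * cost C f' m + C * s
  else 0.

(** The iterated logarithm with rounding down at each level, following the recursion of [cost]. *)
Fixpoint ilog (f s : nat) : nat :=
  if f is f'.+1 then if s <= 1 then 0 else (ilog f' (trunc_log 2 s)).+1 else 0.

Lemma trunc_log2_gt0 s : 1 < s -> 0 < trunc_log 2 s.
Proof. by rewrite trunc_log_gt0. Qed.

(** Sizes at least halve at each level; this yields termination and the space bound of the stack. *)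
Lemma trunc_log2_half s : 1 < s -> 2 * trunc_log 2 s <= s.
Proof.
move=> s1; have := trunc_logP (isT : 1 < 2) (ltnW s1); have := trunc_log2_gt0 s1.
case: (trunc_log 2 s) => // m _; rewrite expnS.
by have := ltn_expl m (isT : 1 < 2); lia.
Qed.

Lemma ngroups_mul s m : 0 < m -> ngroups s m * m <= s + m - 1.
Proof. by move=> _; apply: leq_divM. Qed.

Lemma ngroups_cover s m : 0 < m -> s <= ngroups s m * m.
Proof.
by move=> m0; have := ltn_ceil (s + m - 1) m0; rewrite -/(ngroups s m); lia.
Qed.

Lemma ngroups_ge2 s : 1 < s -> 2 <= ngroups s (trunc_log 2 s).
Proof.
move=> s1; have m0 := trunc_log2_gt0 s1.
by have := ngroups_cover s m0; have := trunc_log2_half s1; nia.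
Qed.

Lemma ngroups_le s : 1 < s -> ngroups s (trunc_log 2 s) <= s.
Proof.
move=> s1; have m0 := trunc_log2_gt0 s1.
by have := ngroups_mul s m0; have := trunc_log2_half s1; nia.
Qed.

Lemma ilog_exp f s : 0 < s -> 2 ^ ilog f s <= 2 * s.
Proof.
elim: f s => [|f IH] s s0 /=; first lia.
case: (leqP s 1) => s1; first lia.
rewrite expnS; have := IH _ (trunc_log2_gt0 s1); have := trunc_log2_half s1; lia.
Qed.

(** Serves only for sizes below [2 ^ 10], where the extra factor [s ^ 2] is absorbed by a
    constant. *)
Lemma cost_crude C f s : 0 < s -> cost C f s <= 3 * C * s ^ 3.
Proof.
elim: f s => [|f IH] s s0 //=; case: (leqP s 1) => s1; first by rewrite (_ : s = 1) ?exp1n; lia.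
have m0 := trunc_log2_gt0 s1; have ms := trunc_log2_half s1.
move: (trunc_log 2 s) m0 ms (IH _ (trunc_log2_gt0 s1)) => m m0 ms h.
have := ngroups_mul s m0; move: (ngroups s m) => N Nm.
have h1 : (2 * N - 1) * cost C f m <= 3 * C * (((2 * N - 1) * m) * m ^ 2).
  move: (2 * N - 1) => u.
  rewrite (_ : 3 * C * _ = u * (3 * C * m ^ 3)); first by rewrite leq_mul.
  by rewrite (expnS m 2); lia.
have h2 : (2 * N - 1) * m <= 2 * s + m by rewrite mulnBl; lia.
have h3 : 3 * ((2 * N - 1) * m * m ^ 2) + s <= 3 * s ^ 3.
  have : (2 * N - 1) * m * m ^ 2 <= (2 * s + m) * m ^ 2 by rewrite leq_mul2r h2 orbT.
  move: ((2 * N - 1) * m * _) => u hu.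
  have h4 : 4 * (m ^ 2) <= s ^ 2 by nia.
  have h5 : 2 * (2 * s + m) <= 5 * s by lia.
  have h6 : 8 * ((2 * s + m) * m ^ 2) <= 5 * s ^ 3.
    have := leq_mul h4 h5; rewrite (expnS s 2); lia.
  have h7 : 4 * s <= s ^ 3 by rewrite !expnS expn0; nia.
  lia.
have := leq_mul (leqnn C) h3; lia.
Qed.

(** Source of the threshold [2 ^ 10]: the inequality fails at 9. *)
Lemma sqr_exp2 m : 10 <= m -> 8 * (m * m) <= 2 ^ m.
Proof.
elim: m => // m IH; rewrite leq_eqVlt => /orP[/eqP<-//|m10].
by rewrite expnS; have := IH m10; nia.
Qed.

(* The summand [- 1] absorbs the additive terms of the recurrence. *)
Lemma cost_bound C D f s : (2 ^ 10) ^ 2 <= D -> 0 < s ->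
  cost C f s <= 3 * C * D * (s * (2 * 2 ^ ilog f s - 1)).
Proof.
move=> D20; elim: f s => [//|f IH] s s0.
have e0 x : 0 < 2 ^ x by rewrite expn_gt0.
case: (ltnP s (2 ^ 10)) => sb.
  apply: leq_trans (cost_crude C f.+1 s0) _.
  rewrite -[leqRHS]mulnA leq_mul // expnS mulnCA leq_mul //.
  rewrite -[leqLHS]muln1 leq_mul //; last by have := e0 (ilog f.+1 s); lia.
  by apply: leq_trans D20; rewrite leq_sqr ltnW.
have s1 : 1 < s by apply: leq_trans sb.
have D1 : 0 < D by apply: leq_trans D20; rewrite !expn_gt0.
rewrite /= [s <= 1]leqNgt s1 /= expnS.
have m0 := trunc_log2_gt0 s1.
have m10 : 10 <= trunc_log 2 s by apply: trunc_log_max.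
have lgs := trunc_logP (isT : 1 < 2) s0.
have Pm := ilog_exp f m0; have h := IH _ m0.
move: (trunc_log 2 s) m0 m10 lgs Pm h => m m0 m10 lgs.
move: (2 ^ ilog f m) (e0 (ilog f m)) => P P0 Pm h.
have := ngroups_mul s m0; move: (ngroups s m) => N Nm.
have CK : 2 * C <= 3 * C * D by nia.
move: (3 * C * D) h CK => K h CK {sb D20 D1 IH}.
have h1 : (2 * N - 1) * cost C f m <= K * (((2 * N - 1) * m) * (2 * P - 1)).
  by apply: leq_trans (leq_mul (leqnn _) h) _; lia.
have h2 : (2 * N - 1) * m <= 2 * s + m by rewrite mulnBl; lia.
(* [P <= 2 * m] makes the left side at most [8 * m ^ 2 <= 2 ^ m <= s]. *)
have h3 : 2 * (m * (2 * P - 1)) <= s.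
  by have := sqr_exp2 m10; nia.
(* The gain from [- 1] is [2 * s] here: [h3] spends one [s] on rounding, and the other, multiplied
   by [K >= 2 * C], pays for [C * s]. *)
have h4 : 2 * ((2 * N - 1) * m * (2 * P - 1)) + s <= 2 * (s * (2 * (2 * P) - 1)).
  have := leq_mul h2 (leqnn (2 * P - 1)); rewrite mulnDl.
  move: ((2 * N - 1) * m * _) => u; nia.
have h5 := leq_mul (leqnn K) h4.
have h6 := leq_mul CK (leqnn s).
move: h1 h5; move: (2 * (2 * P) - 1) ((2 * N - 1) * m * (2 * P - 1)) => z v.
move: ((2 * N - 1) * cost C f m) => u; nia.
Qed.

(** The existential quantifier keeps the large constant opaque in later arithmetic. *)
Lemma cost_log_star : exists D, forall C f s, 0 < s ->
  cost C f s <= 3 * C * D * (s * (2 * 2 ^ ilog f s - 1)).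
Proof.
exists ((2 ^ 10) ^ 2) => C f s s0.
(* [by] and [done] would unfold this number in unary. *)
exact (cost_bound C f (leqnn _) s0).
Qed.

(** * Comparison of the rounded and the real iterated logarithm *)

Lemma ln_le x y : (0 < x)%coqR -> (x <= y)%coqR -> (ln x <= ln y)%coqR.
Proof.
move=> x0 [lt|->]; last exact: Rle_refl.
by apply: Rlt_le; apply: ln_increasing.
Qed.

(** Stated for all reals [x] above [s], because after one step the rounded logarithm is only a lower
    bound of [lg x]. *)
Lemma ilog_lgstar f s x : (INR s <= x)%coqR -> ilog f s <= lgstar x.
Proof.
elim: f s x => [//|f IH] s x sx /=; case: (leqP s 1) => // s1.
have INR1 : (1 < INR s)%coqR by rewrite -[1%coqR]/(INR 1); apply: lt_INR; lia.
rewrite lgstar_gt1 ?add1n ?ltnS; last by apply: Rlt_le_trans sx.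
apply: IH; have l2 := ln2_gt0.
have := trunc_logP (isT : 1 < 2) (ltnW s1); move: (trunc_log 2 s) => m ms.
have pm : (2 ^ m <= INR s)%coqR.
  rewrite (_ : (2 ^ m)%coqR = INR (2 ^ m)); first by apply: le_INR; lia.
  by elim: {ms}m => //= m ->; rewrite expnS mult_INR.
apply: (Rmult_le_reg_r (ln 2)) => //.
rewrite (_ : (lg x * ln 2 = ln x)%coqR); last by rewrite /lg; field; lra.
rewrite -ln_pow; last lra.
by apply: ln_le; [apply: pow_lt; lra | lra].
Qed.

(** * Programs for tournament trees *)

Notation "c1 ;; c2" := (CSeq c1 c2) (at level 60, right associativity).

(* Cells 0 and 1 hold the position reported by the last call, cell 2 the current
   frame (0 when the computation is over), cell 3 is 0 at a call and 1 at a
   return, and cells 4 to 9 are scratch.  A frame is an array of records of 8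
   cells.  Record 0 holds the size, the group size, the number of groups, the
   first row, the first column, the number of finished calls and the parent
   frame.  The other records are the nodes of two tournament trees, one for the
   row groups (minimal key) and one for the column groups (maximal key): cells 0
   and 1 are the winning leaves, and at a leaf, cells 2, 3 and 4, 5 are the
   positions of the entries used as row key and column key.  The boolean
   parameter of the programs below selects the column tree. *)
Definition reg (k : nat) : expr := ELoad (EConst k).
Definition field (k : nat) : expr := EAdd (reg 2) (EConst k).
Definition slot (e : expr) (k : nat) : expr :=
  EAdd (EAdd (reg 2) (EMul (EConst 8) e)) (EConst k).
Definition set (k : nat) (e : expr) : cmd := CStore (EConst k) e.

(** The node to recompute is in cell 4. The comparison is reversed in the column tree, where the
    greatest key wins. *)
Definition winner (b : bool) : cmd :=
  let ki e := ELoad (slot e (2 + 2 * b)) in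
  let kj e := ELoad (slot e (3 + 2 * b)) in
  set 5 (ELoad (slot (EMul (EConst 2) (reg 4)) b)) ;;
  set 6 (ELoad (slot (EAdd (EMul (EConst 2) (reg 4)) (EConst 1)) b)) ;;
  CIf (if b then TEntryLe (ki (reg 6)) (kj (reg 6)) (ki (reg 5)) (kj (reg 5))
       else TEntryLe (ki (reg 5)) (kj (reg 5)) (ki (reg 6)) (kj (reg 6)))
    (CStore (slot (reg 4) b) (reg 5))
    (CStore (slot (reg 4) b) (reg 6)).

Definition climb (b : bool) : cmd :=
  CWhile (TLe (EConst 1) (reg 4)) (winner b ;; set 4 (EDiv (reg 4) (EConst 2))).

(** Nodes are visited in decreasing order, so that both children are ready. *)
Definition build : cmd :=
  CWhile (TLe (EConst 1) (reg 4))
    (winner false ;; winner true ;; set 4 (ESub (reg 4) (EConst 1))).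

Ltac look := repeat match goal with |- context [upd ?m ?a ?v ?x] =>
  first [rewrite (@upd_other m a v x); [|lia] | rewrite (@upd_same m a v x); [|lia]] end.

Section Program.

Variables (n0 : nat) (d : Order.disp_t) (T : orderType d) (A : 'M[T]_n0.+1).
Variables (B W : nat).
Hypotheses (B64 : 64 < B) (BW : B ^ 12 <= W).

Local Notation runs := (runs A B W).
Local Notation entry := (entry A).

Definition dir (b : bool) (x y : T) : bool := if b then (y <= x)%O else (x <= y)%O.

Lemma dir_refl b : reflexive (dir b).
Proof. by move=> x; rewrite /dir; case: b; rewrite lexx. Qed.

Lemma dir_trans b : transitive (dir b).
Proof. by case: b => y x z /= h1 h2; [apply: le_trans h2 h1 | apply: le_trans h1 h2]. Qed.

Definition tree (m : memory) (fp : nat) (b : bool) (l : nat) : nat := m (fp + 8 * l + b).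

Definition node_key (m : memory) (fp : nat) (b : bool) (l : nat) : T :=
  entry (m (fp + 8 * l + (2 + 2 * b))) (m (fp + 8 * l + (3 + 2 * b))).

Definition keys_in (m : memory) (fp N : nat) (b : bool) : Prop := forall l, N <= l < 2 * N ->
  m (fp + 8 * l + (2 + 2 * b)) < n0.+1 /\ m (fp + 8 * l + (3 + 2 * b)) < n0.+1.

Local Notation ok m fp b := (node_ok (dir b) (tree m fp b) (node_key m fp b)).

Lemma runs_winner b m fp i N Q :
  m 2 = fp -> m 4 = i -> 16 <= fp -> fp + 16 * N <= B -> 1 <= i < N ->
  N <= tree m fp b (2 * i) < 2 * N -> N <= tree m fp b (2 * i + 1) < 2 * N ->
  keys_in m fp N b ->
  (forall m', (forall x, x <> 5 -> x <> 6 -> x <> fp + 8 * i + b -> m' x = m x) ->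
     ok m' fp b i -> Q m') ->
  runs (winner b) m 4 Q.
Proof.
move=> m2 m4 fp16 fpB iN l1 l2 kin post.
have bb : b <= 1 by case: (b).
rewrite /tree in l1 l2.
apply: runs_store_seq => //=; try (by case: (b)); rewrite m2 m4; first lia.
apply: runs_store_seq => //=; try (by case: (b)); look; rewrite m2 m4; first lia.
set m1 := upd (upd _ _ _) _ _.
have m1E x : x <> 5 -> x <> 6 -> m1 x = m x by move=> x5 x6; rewrite /m1; look.
have m15 : m1 5 = m (fp + 8 * (2 * i) + b) by rewrite /m1; look.
have m16 : m1 6 = m (fp + 8 * (2 * i + 1) + b) by rewrite /m1; look.
set w1 := m (fp + 8 * (2 * i) + b) in l1 m15.
set w2 := m (fp + 8 * (2 * i + 1) + b) in l2 m16.
have post' w : w = w1 \/ w = w2 -> dir b (node_key m fp b w) (node_key m fp b w1) ->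
    dir b (node_key m fp b w) (node_key m fp b w2) -> Q (upd m1 (fp + 8 * i + b) w).
  move=> ww h1 h2; apply: post.
    by move=> x x5 x6 xi; rewrite upd_other // m1E.
  have tE : tree (upd m1 (fp + 8 * i + b) w) fp b i = w by rewrite /tree; look.
  have t1 : tree (upd m1 (fp + 8 * i + b) w) fp b (2 * i) = w1.
    by rewrite /tree; look; rewrite m1E //; lia.
  have t2 : tree (upd m1 (fp + 8 * i + b) w) fp b (2 * i + 1) = w2.
    by rewrite /tree; look; rewrite m1E //; lia.
  have kE l : N <= l < 2 * N -> node_key (upd m1 (fp + 8 * i + b) w) fp b l = node_key m fp b l.
    by move=> lN; rewrite /node_key; look; rewrite !m1E //; lia.
  rewrite /node_ok tE t1 t2 !kE ?h1 ?h2 ?andbT //; try lia.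
have [i1 j1] := kin _ l1; have [i2 j2] := kin _ l2.
have wB : w1 < B /\ w2 < B by lia.
have bn : (b : nat) = 0 \/ (b : nat) = 1 by case: (b); [right|left].
clear bb.
case: b => /= in kin post w1 w2 l1 l2 i1 j1 i2 j2 m1 m1E m15 m16 post' wB bn *.
  apply: runs_if_entry => //=; rewrite !(m1E 2) // m15 m16 m2 !(m1E (fp + _ + _)) ?i1 ?j1 ?i2 ?j2 //; try lia.
    move=> h; apply: runs_store => //=; rewrite m15; first lia.
    rewrite !(m1E 2) // !(m1E 4) // m2 m4; apply: post'; first by left.
      exact: lexx.
    exact: h.
  move=> /ltW h; apply: runs_store => //=; rewrite m16; first lia.
  rewrite !(m1E 2) // !(m1E 4) // m2 m4; apply: post'; first by right.
    exact: h.
  exact: lexx.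
apply: runs_if_entry => //=; rewrite !(m1E 2) // m15 m16 m2 !(m1E (fp + _ + _)) ?i1 ?j1 ?i2 ?j2 //; try lia.
  move=> h; apply: runs_store => //=; rewrite m15; first lia.
  rewrite !(m1E 2) // !(m1E 4) // m2 m4; apply: post'; first by left.
    exact: lexx.
  exact: h.
move=> /ltW h; apply: runs_store => //=; rewrite m16; first lia.
rewrite !(m1E 2) // !(m1E 4) // m2 m4; apply: post'; first by right.
  exact: h.
exact: lexx.
Qed.

(** Invariant: every node off the path from [i] to the root is correct. [k] bounds the number of
    nodes left on the path, each costing 6 units. *)
Lemma runs_climb b m fp N Q k i :
  m 2 = fp -> m 4 = i -> i < 2 ^ k -> i < N -> 16 <= fp -> fp + 16 * N <= B ->
  leaves_ok N (tree m fp b) -> keys_in m fp N b ->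
  (forall j, 1 <= j < N -> (forall h, j <> i %/ 2 ^ h) -> ok m fp b j) ->
  (forall m', (forall x, x <> 4 -> x <> 5 -> x <> 6 ->
       (forall j, 1 <= j < N -> x <> fp + 8 * j + b) -> m' x = m x) ->
     (forall j, 1 <= j < N -> ok m' fp b j) -> Q m') ->
  runs (climb b) m (6 * k + 1) Q.
Proof.
elim: k m i => [|k IH] m i m2 m4 ik iN fp16 fpB lv kin oks post.
  have i0 : i = 0 by move: ik; rewrite expn0; lia.
  apply: runs_while_false => //=; first by rewrite m4 i0.
  apply: post => // j jN; apply: oks => // h; rewrite i0 div0n; lia.
have [i0|i0] := posnP i.
  apply: (runs_weaken B64 BW (k:=1) (Q:=Q)) => //.
  apply: runs_while_false => //=; first by rewrite m4 i0.
  apply: post => // j jN; apply: oks => // h; rewrite i0 div0n; lia.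
have -> : 6 * k.+1 + 1 = (5 + (6 * k + 1)).+1 by lia.
apply: runs_while_true => //=; first by rewrite m4.
have b1 : b <= 1 by case: (b).
have ch j : (forall h, j <> i %/ 2 ^ h) ->
    (forall h, 2 * j <> i %/ 2 ^ h) /\ (forall h, 2 * j + 1 <> i %/ 2 ^ h).
  move=> na; split=> h e; apply: (na h.+1); rewrite expnSr divnMA -e; lia.
have rng j : 1 <= j < 2 * N -> (forall h, j <> i %/ 2 ^ h) ->
    N <= tree m fp b j < 2 * N.
  exact: (winner_leaf ch oks lv).
have anc h : i %/ 2 ^ h <= i by apply: leq_div.
apply: (runs_seq_le B64 BW (k1:=4)) => //.
apply: (runs_winner m2 m4 fp16 fpB) => //; first lia.
- by apply: rng => [|h]; [lia | have := anc h; lia].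
- by apply: rng => [|h]; [lia | have := anc h; lia].
move=> m1 m1E ok1.
apply: runs_store => //=; rewrite m1E //; try lia.
rewrite m4.
have tE j : j <> i -> tree (upd m1 4 (i %/ 2)) fp b j = tree m fp b j.
  by move=> ji; rewrite /tree; look; rewrite m1E //; lia.
have kE l : N <= l < 2 * N -> node_key (upd m1 4 (i %/ 2)) fp b l = node_key m fp b l.
  by move=> lN; rewrite /node_key; look; rewrite !m1E //; lia.
apply: (IH _ (i %/ 2)) => //.
- by look; rewrite m1E //; lia.
- by rewrite ltn_divLR // -expnSr.
- by have := leq_div i 2; lia.
- by move=> l lN; rewrite tE ?lv //; lia.
- by move=> l lN; look; rewrite !m1E; try lia; apply: kin.
- move=> j jN na; have [->|/eqP ji] := eqVneq j i.
    rewrite (@node_ok_congr _ _ (tree m1 fp b) _ (node_key m1 fp b)) //.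
    + by rewrite /tree; look.
    + by rewrite /tree; look.
    + by rewrite /tree; look.
    + by rewrite /node_key; look.
    + by rewrite /node_key; look.
    + by rewrite /node_key; look.
  have nai h : j <> i %/ 2 ^ h.
    by case: h => [|h]; rewrite ?divn1 // expnS divnMA.
  have [na0 na1] := ch _ nai.
  have ji2 := na 0; rewrite divn1 in ji2.
  rewrite (@node_ok_congr _ _ (tree m fp b) _ (node_key m fp b)) ?tE ?kE ?oks ?rng //; lia.
- move=> m' m'E ok'; apply: post => // x x4 x5 x6 xj.
  by rewrite m'E //; look; apply: m1E => //; apply: xj; lia.
Qed.

Lemma runs_build m fp N Q i :
  m 2 = fp -> m 4 = i -> i < N -> 16 <= fp -> fp + 16 * N <= B ->
  (forall b, leaves_ok N (tree m fp b)) -> (forall b, keys_in m fp N b) ->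
  (forall b j, i < j < N -> ok m fp b j) ->
  (forall m', (forall x, x <> 4 -> x <> 5 -> x <> 6 ->
       (forall (b : bool) j, 1 <= j < N -> x <> fp + 8 * j + b) -> m' x = m x) ->
     (forall b j, 1 <= j < N -> ok m' fp b j) -> Q m') ->
  runs build m (10 * i + 1) Q.
Proof.
elim: i m => [|i IH] m m2 m4 iN fp16 fpB lv kin oks post.
  apply: runs_while_false => //=; first by rewrite m4.
  by apply: post => // b j jN; apply: oks.
have -> : 10 * i.+1 + 1 = (9 + (10 * i + 1)).+1 by lia.
apply: runs_while_true => //=; first by rewrite m4.
have rng b j : i.+1 < j < 2 * N -> N <= tree m fp b j < 2 * N.
  move=> jN; apply: (@winner_leaf _ (dir b) N (fun x => i.+1 < x) (tree m fp b) (node_key m fp b)) => //.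
  - by move=> x; lia.
  - by move=> x x1 xi; apply: oks; lia.
  - by lia.
  - by lia.
apply: (runs_seq_le B64 BW (k1:=4)) => //.
apply: (@runs_winner false _ fp i.+1 N) => //; try (by apply: rng; lia); try lia.
move=> m1 m1E ok1; rewrite /= addn0 in m1E.
apply: (runs_seq_le B64 BW (k1:=4)) => //.
have tE1 j : tree m1 fp true j = tree m fp true j.
  by rewrite /tree m1E //=; lia.
apply: (@runs_winner true _ fp i.+1 N) => //; rewrite ?tE1; try (by apply: rng; lia); try lia.
- by rewrite m1E //; lia.
- by rewrite m1E //; lia.
- by move=> l lN /=; rewrite !m1E; try lia; apply: (kin true).
move=> m2' m2E ok2; rewrite /= in m2E.
apply: runs_store => //=; rewrite m2E // ?m1E //; try lia.
rewrite m4 subn1 /=; set m3 := upd _ _ _.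
have m3E x : x <> 4 -> x <> 5 -> x <> 6 -> x <> fp + 8 * i.+1 -> x <> fp + 8 * i.+1 + 1 ->
    m3 x = m x.
  by move=> x4 x5 x6 x7 x8; rewrite /m3; look; rewrite m2E // m1E.
have tE b j : j <> i.+1 -> tree m3 fp b j = tree m fp b j.
  by move=> ji; rewrite /tree m3E //; case: b => /=; lia.
have kE b l : N <= l < 2 * N -> node_key m3 fp b l = node_key m fp b l.
  by move=> lN; rewrite /node_key !m3E //; case: b => /=; lia.
apply: IH => //.
- by rewrite m3E //; lia.
- lia.
- by move=> b l lN; rewrite tE ?lv //; lia.
- by move=> b l lN; rewrite !m3E; try (by case: (b) => /=; lia); apply: kin.
- move=> b j jN; have [->|/eqP ji] := eqVneq j i.+1; last first.
    by rewrite (@node_ok_congr _ _ (tree m fp b) _ (node_key m fp b)) ?tE ?kE ?oks ?rng //; lia.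
  case: b.
    by rewrite (@node_ok_congr _ _ (tree m2' fp true) _ (node_key m2' fp true)) //;
      rewrite /tree /node_key /m3; look.
  rewrite (@node_ok_congr _ _ (tree m1 fp false) _ (node_key m1 fp false)) //;
    rewrite /tree /node_key /m3 /= ?addn0; look; rewrite ?m2E //; try lia.
- move=> m' m'E ok'; apply: post => // x x4 x5 x6 xj.
  have xf := xj false i.+1; have xt := xj true i.+1; rewrite /= ?addn0 in xf xt.
  by rewrite m'E // m3E //; [apply: xf | apply: xt]; lia.
Qed.

End Program.

(** * One frame of the recursion *)

Definition fld (k : nat) : expr := ELoad (field k).

(* Starts the call on the block of row group [reg 7] and column group [reg 8];
   [x - (x - y)] is the minimum of [x] and [y]. *)
Definition push : cmd :=
  let base := EAdd (reg 2) (EMul (EConst 16) (fld 2)) in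
  let shift r := ESub (EMul (reg r) (fld 1))
                   (ESub (EMul (reg r) (fld 1)) (ESub (fld 0) (fld 1))) in
  CStore (EAdd base (EConst 0)) (fld 1) ;;
  CStore (EAdd base (EConst 3)) (EAdd (fld 3) (shift 7)) ;;
  CStore (EAdd base (EConst 4)) (EAdd (fld 4) (shift 8)) ;;
  CStore (EAdd base (EConst 6)) (reg 2) ;;
  set 2 base ;; set 3 (EConst 0).

Definition log_loop : cmd :=
  CWhile (TLe (reg 9) (fld 0))
    (set 9 (EMul (EConst 2) (reg 9)) ;; CStore (field 1) (EAdd (fld 1) (EConst 1))).

Definition enter : cmd :=
  CStore (field 1) (EConst 0) ;; set 9 (EConst 2) ;;
  log_loop ;;
  CStore (field 2) (EDiv (ESub (EAdd (fld 0) (fld 1)) (EConst 1)) (fld 1)) ;;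
  CStore (field 5) (EConst 0) ;;
  set 7 (EConst 0) ;; set 8 (EConst 0) ;; push.

(** The reported position becomes both keys of the group; the trees are built once the last diagonal
    block is done. *)
Definition absorb_diag : cmd :=
  let l := EAdd (fld 2) (fld 5) in
  CStore (slot l 0) l ;; CStore (slot l 1) l ;;
  CStore (slot l 2) (reg 0) ;; CStore (slot l 3) (reg 1) ;;
  CStore (slot l 4) (reg 0) ;; CStore (slot l 5) (reg 1) ;;
  CIf (TLe (fld 2) (EAdd (fld 5) (EConst 1)))
    (set 4 (ESub (fld 2) (EConst 1)) ;; build) CSkip.

Definition improve (b : bool) : cmd :=
  let ki := slot (reg (7 + b)) (2 + 2 * b) in
  let kj := slot (reg (7 + b)) (3 + 2 * b) in
  CIf (if b then TEntryLe (reg 0) (reg 1) (ELoad ki) (ELoad kj)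
       else TEntryLe (ELoad ki) (ELoad kj) (reg 0) (reg 1))
    (CStore ki (reg 0) ;; CStore kj (reg 1)) CSkip.

(** The groups of the finished call are read again from the roots, since the call may have
    overwritten cells 7 and 8 but not the frame. *)
Definition absorb_off : cmd :=
  set 7 (ELoad (slot (EConst 1) 0)) ;; set 8 (ELoad (slot (EConst 1) 1)) ;;
  improve false ;; improve true ;;
  set 4 (EDiv (reg 7) (EConst 2)) ;; climb false ;;
  set 4 (EDiv (reg 8) (EConst 2)) ;; climb true.

Definition absorb : cmd :=
  CIf (TLe (EAdd (fld 5) (EConst 1)) (fld 2)) absorb_diag absorb_off ;;
  CStore (field 5) (EAdd (fld 5) (EConst 1)).

Definition next : cmd :=
  CIf (TLe (EMul (EConst 2) (fld 2)) (EAdd (fld 5) (EConst 1)))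
    (set 7 (ELoad (slot (EConst 1) 0)) ;;
     set 0 (ELoad (slot (reg 7) 2)) ;; set 1 (ELoad (slot (reg 7) 3)) ;;
     set 3 (EConst 1) ;; set 2 (fld 6))
    (CIf (TLe (EAdd (fld 5) (EConst 1)) (fld 2))
       (set 7 (fld 5) ;; set 8 (fld 5))
       (set 7 (ESub (ELoad (slot (EConst 1) 0)) (fld 2)) ;;
        set 8 (ESub (ELoad (slot (EConst 1) 1)) (fld 2))) ;;
     push).

Definition body : cmd :=
  CIf (TLe (reg 3) (EConst 0))
    (CIf (TLe (fld 0) (EConst 1))
       (set 0 (fld 3) ;; set 1 (fld 4) ;; set 3 (EConst 1) ;; set 2 (fld 6))
       enter)
    (absorb ;; next).

Definition loop : cmd := CWhile (TLe (EConst 1) (reg 2)) body.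

(** The remaining fields of the first frame are read as the initial zeros; in particular its parent
    is 0, which stops the loop. *)
Definition program : cmd := CStore (EConst 16) (reg 0) ;; set 2 (EConst 16) ;; loop.

(* The last group is shifted to the left so that all groups have [m] elements. *)
Definition group_start (s m g : nat) : nat := minn (g * m) (s - m).

Lemma group_start_le s m g : m <= s -> group_start s m g + m <= s.
Proof. by rewrite /group_start; lia. Qed.

Lemma group_cover s m x : 0 < m <= s -> x < s ->
  exists2 g, g < ngroups s m & group_start s m g <= x < group_start s m g + m.
Proof.
move=> /andP[m0 ms] xs; have cov := ngroups_cover s m0.
exists (x %/ m); first by rewrite ltn_divLR //; lia.
by rewrite /group_start; have := divn_eq x m; have := ltn_pmod x m0; lia.
Qed.

(** * Invariants of a frame between two of its calls *)

Section Frame.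

Variables (n0 : nat) (d : Order.disp_t) (T : orderType d) (A : 'M[T]_n0.+1).
Variables (B W : nat).
Hypotheses (B64 : 64 < B) (BW : B ^ 12 <= W) (nB : 32 * n0.+1 + 64 <= B).

Local Notation n := n0.+1.
Local Notation runs := (runs A B W).
Local Notation entry := (entry A).
Local Notation key := (node_key A).

(** A condition on a value only: [v] need not be an entry of the block. *)
Definition block_saddle (s r0 c0 : nat) (v : T) : Prop :=
  (forall x, r0 <= x < r0 + s -> exists2 y, c0 <= y < c0 + s & (v <= entry x y)%O) /\
  (forall y, c0 <= y < c0 + s -> exists2 x, r0 <= x < r0 + s & (entry x y <= v)%O).

Variables (fp s r0 c0 p : nat).
Let mm := trunc_log 2 s.
Let N := ngroups s mm.
Hypotheses (s1 : 1 < s) (r0s : r0 + s <= n) (c0s : c0 + s <= n).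
Hypotheses (fp16 : 16 <= fp) (fpn : fp + 32 * s <= 16 + 32 * n).

Lemma group_size_gt0 : 0 < mm. Proof. exact: trunc_log2_gt0. Qed.

Lemma group_size_half : 2 * mm <= s. Proof. exact: trunc_log2_half. Qed.

Lemma groups_ge2 : 2 <= N.
Proof. exact: ngroups_ge2. Qed.

Lemma groups_le : N <= s.
Proof. exact: ngroups_le. Qed.

(** The witness may lie in any column of the whole block, so that results for different column
    groups can all serve as keys of one row group. *)
Definition row_ok (g : nat) (v : T) : Prop :=
  forall x, r0 + group_start s mm g <= x < r0 + group_start s mm g + mm ->
  exists2 y, c0 <= y < c0 + s & (v <= entry x y)%O.

Definition col_ok (g : nat) (v : T) : Prop :=
  forall y, c0 + group_start s mm g <= y < c0 + group_start s mm g + mm ->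
  exists2 x, r0 <= x < r0 + s & (entry x y <= v)%O.

Record frame (m : memory) (q : nat) : Prop := Frame {
  frame_s : m (fp + 0) = s;
  frame_m : m (fp + 1) = mm;
  frame_N : m (fp + 2) = N;
  frame_r0 : m (fp + 3) = r0;
  frame_c0 : m (fp + 4) = c0;
  frame_q : m (fp + 5) = q;
  frame_p : m (fp + 6) = p }.

Definition diag_state (m : memory) (q : nat) : Prop :=
  forall g, g < q ->
  [/\ forall b, tree m fp b (N + g) = N + g,
      forall (b : bool), m (fp + 8 * (N + g) + (2 + 2 * b)) < n /\
                m (fp + 8 * (N + g) + (3 + 2 * b)) < n,
      key m fp false (N + g) = key m fp true (N + g),
      row_ok g (key m fp false (N + g)) &
      col_ok g (key m fp true (N + g))].

(** The matching has [N] pairs after the [N] diagonal calls and loses one per call, hence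
    [2 * N - q]. *)
Record full_state (m : memory) (q : nat) : Prop := FullState {
  full_leaves : forall b, leaves_ok N (tree m fp b);
  full_keys : forall b, keys_in n0 m fp N b;
  full_nodes : forall b j, 1 <= j < N -> node_ok (dir b) (tree m fp b) (key m fp b) j;
  full_row : forall g, g < N -> row_ok g (key m fp false (N + g));
  full_col : forall g, g < N -> col_ok g (key m fp true (N + g));
  full_narrowed : narrowed N (fun g => key m fp false (N + g))
                             (fun g => key m fp true (N + g)) (2 * N - q) }.

Definition state (m : memory) (q : nat) : Prop :=
  if q < N then diag_state m q else full_state m q.

Definition next_group (m : memory) (b : bool) (q : nat) : nat :=
  if q < N then q else tree m fp b 1 - N.

(** Shows that the invariant survives a call, which writes only to cells below 16 and from the frame
    of the callee on. *)
Lemma state_congr m m' q :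
  (forall x, fp + 8 <= x < fp + 16 * N -> m' x = m x) -> state m q -> state m' q.
Proof.
move=> mE; have n2 := groups_ge2.
have tE b j : 1 <= j < 2 * N -> tree m' fp b j = tree m fp b j.
  by move=> jN; rewrite /tree mE //; case: b => /=; lia.
have iE l (b : bool) : 1 <= l < 2 * N ->
    m' (fp + 8 * l + (2 + 2 * b)) = m (fp + 8 * l + (2 + 2 * b)).
  by move=> jN; rewrite mE //; case: b => /=; lia.
have jE l (b : bool) : 1 <= l < 2 * N ->
    m' (fp + 8 * l + (3 + 2 * b)) = m (fp + 8 * l + (3 + 2 * b)).
  by move=> jN; rewrite mE //; case: b => /=; lia.
have kE b l : 1 <= l < 2 * N -> key m' fp b l = key m fp b l.
  by move=> lN; rewrite /node_key iE // jE.
rewrite /state; case: ltnP => qN.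
  move=> st g gq; have [h1 h2 h3 h4 h5] := st g gq.
  have lN : 1 <= N + g < 2 * N by lia.
  split=> [b|b|||]; first by rewrite tE.
  - by rewrite iE // jE.
  - by rewrite !kE.
  - by rewrite kE.
  - by rewrite kE.
case=> lv ks nd rw cl nr.
have rng b j : 1 <= j < 2 * N -> N <= tree m fp b j < 2 * N.
  by move=> jN; apply: (@winner_leaf _ (dir b) N (fun=> True) _ (key m fp b)) => // i iN _; apply: nd.
split.
- by move=> b l lN; rewrite tE ?lv //; lia.
- by move=> b l lN; rewrite iE ?jE; try lia; apply: ks.
- move=> b j jN; have r1 := rng b j; have r2 := rng b (2 * j); have r3 := rng b (2 * j + 1).
  by rewrite (@node_ok_congr _ _ (tree m fp b) _ (key m fp b)) ?tE ?kE ?nd //; lia.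
- by move=> g gN; rewrite kE; [apply: rw | lia].
- by move=> g gN; rewrite kE; [apply: cl | lia].
- by apply: narrowed_congr nr => g gN; rewrite kE //; lia.
Qed.

Lemma frame_congr m m' q :
  (forall x, fp <= x < fp + 8 -> m' x = m x) -> frame m q -> frame m' q.
Proof. by move=> mE [f0 f1 f2 f3 f4 f5 f6]; split; rewrite mE //; lia. Qed.

(** * Opening a frame and starting a call *)

Lemma runs_push m X Y q Q :
  m 2 = fp -> frame m q -> m 7 = X -> m 8 = Y -> X < N -> Y < N ->
  (forall m', m' 2 = fp + 16 * N -> m' 3 = 0 -> m' (fp + 16 * N + 0) = mm ->
     m' (fp + 16 * N + 3) = r0 + group_start s mm X ->
     m' (fp + 16 * N + 4) = c0 + group_start s mm Y ->
     m' (fp + 16 * N + 6) = fp ->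
     (forall x, 16 <= x < fp + 16 * N -> m' x = m x) -> Q m') ->
  runs push m 6 Q.
Proof.
move=> f2 fr m7 m8 XN YN post.
have [f3 f4 f5 f6 f7 f8 f9] := fr.
have n2 := groups_ge2; have ns := groups_le; have mh := group_size_half.
have sX := @group_start_le s mm X; have sY := @group_start_le s mm Y.
rewrite /group_start minnE in sX sY post; rewrite minnE in post.
apply: runs_store_seq => //=; rewrite ?f2 ?f3 ?f4 ?f5; first lia.
apply: runs_store_seq => //=; look; rewrite ?f2; look; rewrite ?f2 ?f3 ?f4 ?f5 ?f6 ?m7; first lia.
apply: runs_store_seq => //=; look; rewrite ?f2; look; rewrite ?f2 ?f3 ?f4 ?f5 ?f7 ?m8; first lia.
apply: runs_store_seq => //=; look; rewrite ?f2; look; rewrite ?f2 ?f5; first lia.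
apply: runs_store_seq => //=; look; rewrite ?f2; look; rewrite ?f2 ?f5; first lia.
apply: runs_store => //=; first lia.
apply: post; try (by look).
by move=> x xN; look.
Qed.

(** After [j] rounds cell 9 holds [2 ^ j.+1]; the loop stops when this exceeds [s], that is at
    [j = mm], and [r] counts the rounds left. *)
Lemma runs_log_loop m j r Q :
  m 2 = fp -> m (fp + 0) = s -> m 9 = 2 ^ j.+1 -> m (fp + 1) = j -> 2 ^ j <= s ->
  mm = j + r ->
  (forall m', m' (fp + 1) = mm -> (forall x, x <> 9 -> x <> fp + 1 -> m' x = m x) -> Q m') ->
  runs log_loop m (3 * r + 1) Q.
Proof.
elim: r m j => [|r IH] m j m2 ms m9 mj js mr post.
  apply: runs_while_false => //=.
    rewrite m2 ms m9; have -> : j = mm by lia.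
    by apply: trunc_log_ltn.
  by apply: post => //; rewrite mj mr addn0.
have js' : 2 ^ j.+1 <= s.
  apply: leq_trans (trunc_logP (isT : 1 < 2) (ltnW s1)).
  by rewrite leq_exp2l // -/mm; lia.
have -> : 3 * r.+1 + 1 = (2 + (3 * r + 1)).+1 by lia.
apply: runs_while_true => //=; first by rewrite m2 ms m9.
apply: runs_store_seq => //=; rewrite m9; first lia.
have mh := group_size_half.
apply: runs_store => //=; look; rewrite ?m2; look; rewrite mj; first lia.
apply: (IH _ j.+1) => //; try (by look); try lia.
- by look; rewrite addn1.
- by move=> m' m'1 m'E; apply: post => // x x9 xf; rewrite m'E //; look.
Qed.

Lemma runs_enter m Q :
  m 2 = fp -> m (fp + 0) = s -> m (fp + 3) = r0 -> m (fp + 4) = c0 -> m (fp + 6) = p ->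
  (forall m', m' 2 = fp + 16 * N -> m' 3 = 0 -> m' (fp + 16 * N + 0) = mm ->
     m' (fp + 16 * N + 3) = r0 + group_start s mm 0 ->
     m' (fp + 16 * N + 4) = c0 + group_start s mm 0 ->
     m' (fp + 16 * N + 6) = fp -> frame m' 0 ->
     (forall x, 16 <= x < fp -> m' x = m x) -> Q m') ->
  runs enter m (3 * mm + 13) Q.
Proof.
move=> m2 ms mr mc mp post.
have mh := group_size_half; have n2 := groups_ge2; have ns := groups_le; have m0 := group_size_gt0.
have nm := ngroups_mul s m0; rewrite -/N in nm.
apply: runs_store_seq => //=; try lia.
rewrite m2; apply: runs_store_seq => //=; try lia.
have -> : 3 * mm + 13 - 1 - 1 = (3 * mm + 1) + 10 by lia.
apply: runs_seq => //; apply: (@runs_log_loop _ 0) => //; try (by look); try lia.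
move=> m1 m1m m1E.
have {}m1E x : x <> 9 -> x <> fp + 1 -> m1 x = m x.
  by move=> x9 xf; rewrite m1E //; look.
apply: runs_store_seq => //=; rewrite !(m1E 2) ?m2 ?(m1E (fp + 0)) ?ms ?m1m ?m1E //; try lia.
  by have -> : (s + mm - 1) %/ mm = N by []; lia.
have m12 : m1 2 = fp by rewrite m1E //; lia.
have m1s : m1 (fp + 0) = s by rewrite m1E //; lia.
have m1r : m1 (fp + 3) = r0 by rewrite m1E //; lia.
have m1c : m1 (fp + 4) = c0 by rewrite m1E //; lia.
have m1p : m1 (fp + 6) = p by rewrite m1E //; lia.
apply: runs_store_seq => //=; look; rewrite ?m12; try lia.
apply: runs_store_seq => //=; look; rewrite ?m12; try lia.
apply: runs_store_seq => //=; look; rewrite ?m12; try lia.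
set m2' := upd _ 8 _.
have m2E x : 16 <= x -> x <> fp + 2 -> x <> fp + 5 -> m2' x = m1 x.
  by move=> x16 x2 x5; rewrite /m2'; look.
have fr2 : frame m2' 0.
  by split; try (rewrite m2E //; lia); rewrite /m2'; look.
apply: (@runs_push m2' 0 0 0) => //; try (by rewrite /m2'; look); try lia.
move=> m' h1 h2 h3 h4 h5 h6 m'E; apply: post => //.
  by apply: frame_congr fr2 => x xf; apply: m'E; lia.
move=> x xf; rewrite m'E; last lia.
by rewrite m2E ?m1E //; lia.
Qed.


(** * Absorbing the result of a finished call *)

Lemma block_row_ok g h v : block_saddle mm (r0 + group_start s mm g) (c0 + group_start s mm h) v ->
  row_ok g v.
Proof.
case=> rw _ x xg; have [y yh vy] := rw x xg; exists y => //.
have := group_size_half; have := @group_start_le s mm h; lia.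
Qed.

Lemma block_col_ok g h v : block_saddle mm (r0 + group_start s mm g) (c0 + group_start s mm h) v ->
  col_ok h v.
Proof.
case=> _ cl y yh; have [x xg vx] := cl y yh; exists x => //.
have := group_size_half; have := @group_start_le s mm g; lia.
Qed.

Lemma diag_step m m1 q :
  diag_state m q -> q < N -> m 0 < n -> m 1 < n ->
  block_saddle mm (r0 + group_start s mm q) (c0 + group_start s mm q) (entry (m 0) (m 1)) ->
  (forall b, tree m1 fp b (N + q) = N + q) ->
  (forall b : bool, m1 (fp + 8 * (N + q) + (2 + 2 * b)) = m 0) ->
  (forall b : bool, m1 (fp + 8 * (N + q) + (3 + 2 * b)) = m 1) ->
  (forall x, fp + 8 <= x < fp + 8 * (N + q) -> m1 x = m x) ->
  diag_state m1 q.+1.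
Proof.
move=> st qN m0 m1n bs tE iE jE mE g gq; have n2 := groups_ge2.
have [->|/eqP gq'] := eqVneq g q.
  have kE b : key m1 fp b (N + q) = entry (m 0) (m 1) by rewrite /node_key iE jE.
  split; rewrite ?kE //.
  - by move=> b; rewrite iE jE.
  - exact: block_row_ok bs.
  - exact: block_col_ok bs.
have [h1 h2 h3 h4 h5] := st g ltac:(lia).
have cE k : k < 8 -> m1 (fp + 8 * (N + g) + k) = m (fp + 8 * (N + g) + k).
  by move=> k8; apply: mE; lia.
have kE b : key m1 fp b (N + g) = key m fp b (N + g).
  by rewrite /node_key !cE //; case: (b).
split; rewrite ?kE //.
- by move=> b; rewrite -[RHS](h1 b) /tree cE //; case: (b).
- by move=> b; have := h2 b; rewrite !cE //; case: (b).
Qed.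

Lemma runs_absorb_diag m q Q :
  m 2 = fp -> frame m q -> q < N -> diag_state m q -> m 0 < n -> m 1 < n ->
  block_saddle mm (r0 + group_start s mm q) (c0 + group_start s mm q) (entry (m 0) (m 1)) ->
  (forall m', m' 2 = fp -> frame m' q -> state m' q.+1 ->
     (forall x, 16 <= x < fp -> m' x = m x) -> Q m') ->
  runs absorb_diag m (8 + (q.+1 == N) * (10 * N)) Q.
Proof.
move=> m2 fr qN st m0 m1n bs post.
have [f0 f1 f2 f3 f4 f5 f6] := fr.
have n2 := groups_ge2; have ns := groups_le.
apply: runs_store_seq => //=; rewrite ?m2 ?f2 ?f5; try lia.
apply: runs_store_seq => //=; look; rewrite ?m2; look; rewrite ?f2 ?f5; try lia.
apply: runs_store_seq => //=; look; rewrite ?m2; look; rewrite ?f2 ?f5; try lia.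
apply: runs_store_seq => //=; look; rewrite ?m2; look; rewrite ?f2 ?f5; try lia.
apply: runs_store_seq => //=; look; rewrite ?m2; look; rewrite ?f2 ?f5; try lia.
apply: runs_store_seq => //=; look; rewrite ?m2; look; rewrite ?f2 ?f5; try lia.
set m1 := upd _ (_ + 5) _.
have m1E x : 2 <= x < fp + 8 * (N + q) -> m1 x = m x by move=> xl; rewrite /m1; look.
have st1 : diag_state m1 q.+1.
  apply: (diag_step st) => //.
  - by case; rewrite /tree /m1; look.
  - by case; rewrite /m1 /=; look.
  - by case; rewrite /m1 /=; look.
  - by move=> x xl; apply: m1E; lia.
have fr1 : frame m1 q by apply: frame_congr fr => x xl; apply: m1E; lia.
have m12 : m1 2 = fp by rewrite m1E //; lia.
have {}m1E x : 16 <= x < fp -> m1 x = m x by move=> xl; apply: m1E; lia.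
move: m1 st1 fr1 m12 m1E => m3 st1 fr1 m12 m1E.
have [g0 g1 g2 g3 g4 g5 g6] := fr1.
have [qN'|qN'] := eqVneq q.+1 N; last first.
  apply: (runs_weaken B64 BW (k := 1) (Q := Q)) => //; try lia.
  apply: runs_if_le => //=; rewrite m12 g2 g5 => h; first lia.
  apply: runs_skip => //; apply: post => //.
  by rewrite /state; have -> : q.+1 < N by lia.
have -> : 8 + true * (10 * N) - 1 - 1 - 1 - 1 - 1 - 1 = (10 * N + 1).+1 by lia.
apply: runs_if_le => //=; rewrite m12 g2 g5 => h; last lia.
have -> : 10 * N + 1 = 1 + 10 * N by lia.
apply: runs_seq => //; apply: runs_store => //=; rewrite ?m12 ?g2; first lia.
set m4 := upd _ _ _.
have m4E x : 16 <= x -> m4 x = m3 x by move=> x16; rewrite /m4; look.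
have tE b l : tree m4 fp b l = tree m3 fp b l by rewrite /tree m4E //; lia.
have kE b l : key m4 fp b l = key m3 fp b l by rewrite /node_key !m4E //; lia.
apply: (runs_weaken B64 BW (k := 10 * (N - 1) + 1) (Q := Q)) => //; try lia.
apply: (@runs_build _ _ _ A B W B64 BW m4 fp N) => //; try (by rewrite /m4; look); try lia.
- move=> b l lN; rewrite tE; have [h1 _ _ _ _] := st1 (l - N) ltac:(lia).
  by have := h1 b; rewrite subnKC //; lia.
- move=> b l lN; rewrite !m4E; try lia; have [_ h1 _ _ _] := st1 (l - N) ltac:(lia).
  by have := h1 b; rewrite subnKC //; lia.
move=> m' m'E ok'.
have m'E1 x : 16 <= x -> ~~ (fp + 8 <= x < fp + 8 * N) -> m' x = m3 x.
  by move=> x16 xf; rewrite m'E ?m4E //; try lia; move=> b j jN; case: b => /=; lia.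
have kE' b l : N <= l < 2 * N -> key m' fp b l = key m3 fp b l.
  by move=> lN; rewrite /node_key !m'E1 //; lia.
apply: post.
- by rewrite m'E; try lia; rewrite /m4; look.
- by apply: frame_congr fr1 => x xl; apply: m'E1; lia.
- rewrite /state qN' ltnn; split.
  + move=> b l lN; rewrite /tree m'E1; try lia.
    have [h1 _ _ _ _] := st1 (l - N) ltac:(lia).
    by have := h1 b; rewrite /tree subnKC //; lia.
  + move=> b l lN; rewrite !m'E1; try lia; have [_ h1 _ _ _] := st1 (l - N) ltac:(lia).
    by have := h1 b; rewrite subnKC //; lia.
  + exact: ok'.
  + by move=> g gN; rewrite kE'; try lia; have [] := st1 g ltac:(lia).
  + by move=> g gN; rewrite kE'; try lia; have [] := st1 g ltac:(lia).
  + rewrite (_ : 2 * N - N = N); last lia.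
    apply: narrowed_init => g gN; rewrite !kE'; try lia.
    by have [] := st1 g ltac:(lia).
- by move=> x xl; rewrite m'E1 ?m1E //; lia.
Qed.

Lemma runs_improve (b : bool) m X Q :
  m 2 = fp -> m (7 + b) = X -> m 0 < n -> m 1 < n ->
  m (fp + 8 * X + (2 + 2 * b)) < n -> m (fp + 8 * X + (3 + 2 * b)) < n ->
  (forall m', (forall x, x <> fp + 8 * X + (2 + 2 * b) -> x <> fp + 8 * X + (3 + 2 * b) ->
       m' x = m x) ->
     m' (fp + 8 * X + (2 + 2 * b)) < n -> m' (fp + 8 * X + (3 + 2 * b)) < n ->
     key m' fp b X = (if b then Order.min else Order.max) (key m fp b X) (entry (m 0) (m 1)) ->
     Q m') ->
  runs (improve b) m 3 Q.
Proof.
move=> m2 m7 m0 m1 kx1 kx2 post.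
case: b => /= in m7 kx1 kx2 post *.
- apply: runs_if_entry => //=; rewrite ?m2 ?m7 ?m0 ?m1 ?kx1 ?kx2 // => h.
    apply: runs_store_seq => //=; rewrite ?m2 ?m7 //; first lia.
    apply: runs_store => //=; look; rewrite ?m2 ?m7; look; first lia.
    apply: post; try (by look).
    + by move=> x x1 x2; look.
    + by rewrite /node_key /=; look; rewrite min_r.
  apply: (runs_weaken B64 BW (k := 0) (Q := Q)) => //; apply: runs_skip => //; apply: post => //.
  by rewrite min_l // ltW.
- apply: runs_if_entry => //=; rewrite ?m2 ?m7 ?m0 ?m1 ?kx1 ?kx2 // => h.
    apply: runs_store_seq => //=; rewrite ?m2 ?m7 //; first lia.
    apply: runs_store => //=; look; rewrite ?m2 ?m7; look; first lia.
    apply: post; try (by look).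
    + by move=> x x1 x2; look.
    + by rewrite /node_key /=; look; rewrite max_r.
  apply: (runs_weaken B64 BW (k := 0) (Q := Q)) => //; apply: runs_skip => //; apply: post => //.
  by rewrite max_l // ltW.
Qed.

Lemma full_root m q b : full_state m q -> N <= tree m fp b 1 < 2 * N.
Proof.
case=> lv ks nd _ _ _; have n2 := groups_ge2.
apply: (@winner_leaf _ (dir b) N (fun=> True) _ (key m fp b)) => //; last lia.
by move=> i iN _; apply: nd.
Qed.

Lemma full_best m q b g : full_state m q -> g < N ->
  dir b (key m fp b (tree m fp b 1)) (key m fp b (N + g)).
Proof.
case=> lv ks nd _ _ _ gN; have n2 := groups_ge2.
have := @root_best _ (dir b) N (@dir_refl _ _ b) (@dir_trans _ _ b) (tree m fp b) (key m fp b)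
  (N + g) (nd b) ltac:(lia).
by rewrite (lv b (N + g)) //; lia.
Qed.

Lemma exp_log_bound x : x < s -> x < 2 ^ mm.+1.
Proof. by move=> xs; apply: ltn_trans xs _; apply: trunc_log_ltn. Qed.

(** [m0] is the memory before the key of leaf [X] changed; its correct tree gives the invariant of
    [runs_climb] off the path. The path has at most [mm.+1] nodes because [N <= s < 2 ^ mm.+1]. *)
Lemma runs_climb_update (b : bool) m0 m X Q :
  m 2 = fp -> m 4 = X %/ 2 -> N <= X < 2 * N ->
  leaves_ok N (tree m0 fp b) ->
  (forall j, 1 <= j < N -> node_ok (dir b) (tree m0 fp b) (key m0 fp b) j) ->
  (forall j, 1 <= j < 2 * N -> tree m fp b j = tree m0 fp b j) ->
  (forall l, N <= l < 2 * N -> l <> X -> key m fp b l = key m0 fp b l) ->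
  keys_in n0 m fp N b ->
  (forall m', (forall x, x <> 4 -> x <> 5 -> x <> 6 ->
       (forall j, 1 <= j < N -> x <> fp + 8 * j + b) -> m' x = m x) ->
     (forall j, 1 <= j < N -> node_ok (dir b) (tree m' fp b) (key m' fp b) j) -> Q m') ->
  runs (climb b) m (6 * mm.+1 + 1) Q.
Proof.
move=> m2 m4 XN lv nd tE kE kin post; have ns := groups_le.
apply: (@runs_climb _ _ _ A B W B64 BW b m fp N Q _ (X %/ 2)) => //; try lia.
- by apply: exp_log_bound; lia.
- by move=> l lN; rewrite tE ?lv //; lia.
- move=> j jN na.
  have rng i : 1 <= i < 2 * N -> N <= tree m0 fp b i < 2 * N.
    by move=> iN; apply: (@winner_leaf _ (dir b) N (fun=> True) _ (key m0 fp b)) => // x xN _; apply: nd.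
  rewrite (@node_ok_congr _ _ (tree m0 fp b) _ (key m fp b)) ?tE //; try lia.
  by apply: (@node_ok_key_update _ (dir b) N _ _ _ X j nd) => //; lia.
Qed.

Lemma runs_absorb_off m q X Y Q :
  m 2 = fp -> frame m q -> N <= q < 2 * N - 1 -> full_state m q -> m 0 < n -> m 1 < n ->
  X = tree m fp false 1 -> Y = tree m fp true 1 ->
  block_saddle mm (r0 + group_start s mm (X - N)) (c0 + group_start s mm (Y - N))
    (entry (m 0) (m 1)) ->
  (forall m', m' 2 = fp -> frame m' q -> state m' q.+1 ->
     (forall x, 16 <= x < fp -> m' x = m x) -> Q m') ->
  runs absorb_off m (12 * mm + 24) Q.
Proof.
move=> m2 fr qN st m0 m1n XE YE bs post.
have [f0 f1 f2 f3 f4 f5 f6] := fr.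
have n2 := groups_ge2; have ns := groups_le.
have XN := full_root false st; rewrite -XE in XN.
have YN := full_root true st; rewrite -YE in YN.
have rbest g := @full_best m q false g st; rewrite -XE /= in rbest.
have cbest g := @full_best m q true g st; rewrite -YE /= in cbest.
have [lv ks nd rw cl nr] := st.
have XE' : m (fp + 8 * 1 + 0) = X by rewrite XE.
have YE' : m (fp + 8 * 1 + 1) = Y by rewrite YE.
apply: runs_store_seq => //=; rewrite ?m2 ?XE'; try lia.
apply: runs_store_seq => //=; look; rewrite ?m2; look; rewrite ?YE'; try lia.
set m1 := upd _ 8 _.
have m1E x : x <> 7 -> x <> 8 -> m1 x = m x by move=> x7 x8; rewrite /m1; look.
have m17 : m1 7 = X by rewrite /m1; look.
have m18 : m1 8 = Y by rewrite /m1; look.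
clearbody m1.
apply: (runs_seq_le B64 BW (k1 := 3)) => //; first lia.
have [kX1 kX2] := ks false X XN; have [kY1 kY2] := ks true Y YN; rewrite /= in kX1 kX2 kY1 kY2.
apply: (@runs_improve false m1 X) => //=; rewrite ?m1E //; try lia.
move=> m2' m2E rX1 rX2 kX.
apply: (runs_seq_le B64 BW (k1 := 3)) => //; first lia.
have low x : x < fp -> m2' x = m1 x by move=> xf; rewrite m2E //; lia.
have l0 : m2' 0 = m 0 by rewrite low ?m1E //; lia.
have l1 : m2' 1 = m 1 by rewrite low ?m1E //; lia.
have l2 : m2' 2 = fp by rewrite low ?m1E //; lia.
have l8 : m2' (7 + true) = Y by rewrite /= low //; lia.
apply: (runs_improve l2 l8); rewrite ?l0 ?l1 //.
- by rewrite m2E ?m1E //=; lia.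
- by rewrite m2E ?m1E //=; lia.
clear l0 l1 l2 l8.
move=> m3 m3E rY1 rY2 kY.
have {}low x : x <> 7 -> x <> 8 -> x < fp + 8 * N -> m3 x = m x.
  by move=> x7 x8 xf; rewrite m3E ?m2E ?m1E //; lia.
have m37 : m3 7 = X by rewrite m3E ?m2E //; lia.
have m38 : m3 8 = Y by rewrite m3E ?m2E //; lia.
have {}kX : key m3 fp false X = Order.max (key m fp false X) (entry (m 0) (m 1)).
  have -> : key m3 fp false X = key m2' fp false X by rewrite /node_key /= !m3E //; lia.
  by rewrite kX /node_key /= !m1E //; lia.
have {}kY : key m3 fp true Y = Order.min (key m fp true Y) (entry (m 0) (m 1)).
  by rewrite kY /node_key /= !m2E ?m1E //; lia.
have kX' l : N <= l < 2 * N -> l <> X -> key m3 fp false l = key m fp false l.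
  by move=> lN lX; rewrite /node_key /= !m3E ?m2E ?m1E //; lia.
have kY' l : N <= l < 2 * N -> l <> Y -> key m3 fp true l = key m fp true l.
  by move=> lN lX; rewrite /node_key /= !m3E ?m2E ?m1E //; lia.
have t3 b j : 1 <= j < 2 * N -> tree m3 fp b j = tree m fp b j.
  by move=> jN; rewrite /tree m3E ?m2E ?m1E //; case: b => /=; lia.
have ks3 b : keys_in n0 m3 fp N b.
  move=> l lN; case: b => /=.
    have [->|/eqP lY] := eqVneq l Y; first by [].
    by rewrite !m3E ?m2E ?m1E; try lia; apply: (ks true).
  have [->|/eqP lX] := eqVneq l X; first by rewrite !m3E //; lia.
  by rewrite !m3E ?m2E ?m1E; try lia; apply: (ks false).
clear m1 m1E m17 m18 m2' m2E rX1 rX2 m3E rY1 rY2.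
apply: runs_store_seq => //=; rewrite ?m37; try lia.
set m4 := upd m3 _ _.
have m4E x : x <> 4 -> m4 x = m3 x by move=> x4; rewrite /m4; look.
have t4 b j : 1 <= j < 2 * N -> tree m4 fp b j = tree m3 fp b j.
  by move=> jN; rewrite /tree m4E //; lia.
have k4 b l : key m4 fp b l = key m3 fp b l by rewrite /node_key !m4E //; lia.
apply: (runs_seq_le B64 BW (k1 := 6 * mm.+1 + 1)) => //; first lia.
apply: (@runs_climb_update false m m4 X) => //.
- by rewrite m4E ?low //; lia.
- exact: nd.
- by move=> j jN; rewrite t4 ?t3.
- by move=> l lN lX; rewrite k4 kX'.
- by move=> l lN; rewrite !m4E; try lia; apply: ks3.
move=> m5 m5E nd5; rewrite /= in m5E.
have m5E' x : x <> 4 -> x <> 5 -> x <> 6 -> ~~ (fp + 8 <= x < fp + 8 * N) -> m5 x = m3 x.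
  by move=> x4 x5 x6 xN; rewrite m5E ?m4E //; move=> j jN; lia.
apply: runs_store_seq => //=; rewrite ?m5E' ?m38; try lia.
set m6 := upd m5 _ _.
have m6E x : x <> 4 -> m6 x = m5 x by move=> x4; rewrite /m6; look.
have t6 b j : tree m6 fp b j = tree m5 fp b j by rewrite /tree m6E //; lia.
have k6 b l : key m6 fp b l = key m5 fp b l by rewrite /node_key !m6E //; lia.
have t5 j : 1 <= j < 2 * N -> tree m5 fp true j = tree m fp true j.
  by move=> jN; rewrite -t3 // -t4 // /tree m5E //= ; try lia; move=> i iN; lia.
have k5 b l : N <= l < 2 * N -> key m5 fp b l = key m3 fp b l.
  by move=> lN; rewrite /node_key !m5E' //; case: b => /=; lia.
apply: (runs_weaken B64 BW (k := 6 * mm.+1 + 1) (Q := Q)) => //; first lia.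
apply: (@runs_climb_update true m m6 Y) => //.
- by rewrite m6E ?m5E' ?low //; lia.
- exact: nd.
- by move=> j jN; rewrite t6 t5.
- by move=> l lN lY; rewrite k6 k5 // kY'.
- by move=> l lN; rewrite !m6E ?m5E'; try (by case: (b) => /=; lia); try lia; apply: ks3.
move=> m7 m7E nd7; rewrite /= in m7E.
have m7E' x : x <> 4 -> x <> 5 -> x <> 6 -> ~~ (fp + 8 <= x < fp + 8 * N) -> m7 x = m3 x.
  by move=> x4 x5 x6 xN; rewrite m7E ?m6E ?m5E' //; move=> j jN; lia.
have k7 b l : N <= l < 2 * N -> key m7 fp b l = key m3 fp b l.
  by move=> lN; rewrite /node_key !m7E' //; case: b => /=; lia.
have t7 j : 1 <= j < 2 * N -> tree m7 fp false j = tree m5 fp false j.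
  by move=> jN; rewrite -t6 /tree m7E //= ; try lia; move=> i iN; lia.
have lv7 b : leaves_ok N (tree m7 fp b).
  move=> l lN; transitivity (tree m3 fp b l); last by rewrite t3 ?lv //; lia.
  by rewrite /tree m7E' //; case: (b) => /=; lia.
have r5 j : 1 <= j < 2 * N -> N <= tree m5 fp false j < 2 * N.
  move=> jN; apply: (@winner_leaf _ (dir false) N (fun=> True) _ (key m5 fp false)) => //.
    by move=> i iN _; apply: nd5.
  by move=> l lN; rewrite -t7 ?lv7 //; lia.
apply: post.
- by rewrite m7E' ?low //; lia.
- by apply: frame_congr fr => x xl; rewrite m7E' ?low //; lia.
- rewrite /state; have -> : (q.+1 < N) = false by lia.
  split=> //.
  + move=> b l lN; rewrite !m7E'; try (by case: (b) => /=; lia); exact: ks3.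
  + case=> j jN; first exact: nd7.
    by rewrite (@node_ok_congr _ _ (tree m5 fp false) _ (key m5 fp false)) ?nd5 //
      ?t7 // ?k7 ?k5 ?r5 //; lia.
  + move=> g gN; rewrite k7; last lia.
    have [e|/eqP ne] := eqVneq (N + g) X; last by rewrite kX' //; [apply: rw | lia].
    rewrite e kX; have e' : g = X - N by lia.
    (* The maximum is either the old key or the new value, and both are valid. *)
    rewrite -e maxElt; case: ifP => _; last exact: rw.
    by rewrite e'; apply: block_row_ok bs.
  + move=> g gN; rewrite k7; last lia.
    have [e|/eqP ne] := eqVneq (N + g) Y; last by rewrite kY' //; [apply: cl | lia].
    rewrite e kY; have e' : g = Y - N by lia.
    rewrite -e minElt; case: ifP => _; first exact: cl.
    by rewrite e'; apply: block_col_ok bs.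
  + have X' : N + (X - N) = X by lia.
    have Y' : N + (Y - N) = Y by lia.
    apply: (@narrowed_step _ _ N (fun g => key m fp false (N + g)) (fun g => key m fp true (N + g))
      _ _ (X - N) (Y - N) (entry (m 0) (m 1))); rewrite /= ?X' ?Y'; try lia.
    * exact: rbest.
    * exact: cbest.
    * by move=> x xN xX; rewrite k7 ?kX' //; lia.
    * by move=> x xN xX; rewrite k7 ?kY' //; lia.
    * by rewrite k7.
    * by rewrite k7.
    * by rewrite (_ : (2 * N - q.+1).+1 = 2 * N - q) //; lia.
- by move=> x xl; rewrite m7E' ?low //; lia.
Qed.

(** * Passing from one call to the next, and returning *)

Record calling (m : memory) (q : nat) : Prop := Calling {
  calling_fp : m 2 = fp + 16 * N;
  calling_mode : m 3 = 0;
  calling_s : m (fp + 16 * N + 0) = mm;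
  calling_r0 : m (fp + 16 * N + 3) = r0 + group_start s mm (next_group m false q);
  calling_c0 : m (fp + 16 * N + 4) = c0 + group_start s mm (next_group m true q);
  calling_p : m (fp + 16 * N + 6) = fp;
  calling_frame : frame m q;
  calling_state : state m q }.

Lemma runs_absorb m q Q :
  m 2 = fp -> frame m q -> state m q -> q < 2 * N - 1 -> m 0 < n -> m 1 < n ->
  block_saddle mm (r0 + group_start s mm (next_group m false q))
    (c0 + group_start s mm (next_group m true q)) (entry (m 0) (m 1)) ->
  (forall m', m' 2 = fp -> frame m' q.+1 -> state m' q.+1 ->
     (forall x, 16 <= x < fp -> m' x = m x) -> Q m') ->
  runs absorb m (12 * mm + 26 + (q.+1 == N) * (10 * N)) Q.
Proof.
move=> m2 fr st qN m0 m1 bs post; have ns := groups_le.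
have [f0 f1 f2 f3 f4 f5 f6] := fr.
have tail m' : m' 2 = fp -> frame m' q -> state m' q.+1 ->
    (forall x, 16 <= x < fp -> m' x = m x) ->
    runs (CStore (field 5) (EAdd (fld 5) (EConst 1))) m' 1 Q.
  move=> m'2 fr' st' m'E; have [h0 h1 h2 h3 h4 h5 h6] := fr'.
  apply: runs_store => //=; rewrite m'2 h5; first lia.
  apply: post.
  - by look.
  - by split; look => //; lia.
  - by apply: state_congr st' => x xf; look.
  - by move=> x xf; look; apply: m'E.
have -> : 12 * mm + 26 + (q.+1 == N) * (10 * N) =
  (12 * mm + 24 + (q.+1 == N) * (10 * N)).+1 + 1 by lia.
apply: runs_seq => //; apply: runs_if_le => //=; rewrite m2 f2 f5 => h.
  have qN' : q < N by lia.
  rewrite /state /next_group qN' in st bs.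
  apply: (runs_weaken B64 BW (k := 8 + (q.+1 == N) * (10 * N))
           (Q := fun m' => runs (CStore (field 5) (EAdd (fld 5) (EConst 1))) m' 1 Q)) => //; first lia.
  exact: (@runs_absorb_diag m q).
have qN' : (q < N) = false by lia.
rewrite /state /next_group qN' in st bs.
apply: (runs_weaken B64 BW (k := 12 * mm + 24)
         (Q := fun m' => runs (CStore (field 5) (EAdd (fld 5) (EConst 1))) m' 1 Q)) => //; first lia.
by apply: (runs_absorb_off m2 fr _ st m0 m1 erefl erefl bs) => //; lia.
Qed.

(** One pair is left, so all column keys are below all row keys; the least row key is then at most
    some entry of each row and at least some entry of each column. *)
Lemma full_saddle m : full_state m (2 * N - 1) ->
  block_saddle s r0 c0 (key m fp false (tree m fp false 1)).
Proof.
move=> st; have n2 := groups_ge2; have mh := group_size_half; have m0 := group_size_gt0.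
have rN := full_root false st.
have best g := @full_best m (2 * N - 1) false g st; rewrite /= in best.
have [lv ks nd rw cl nr] := st.
rewrite (_ : 2 * N - (2 * N - 1) = 1) in nr; last lia.
have cr := narrowed1 nr.
have gc x : x < s -> exists2 g, g < N & group_start s mm g <= x < group_start s mm g + mm.
  by apply: group_cover; lia.
split=> x xs.
  have [g gN xg] := gc (x - r0) ltac:(lia).
  have [y yc yv] := rw g gN x ltac:(lia).
  by exists y => //; apply: le_trans yv; apply: best.
have [g gN xg] := gc (x - c0) ltac:(lia).
have [y yc yv] := cl g gN x ltac:(lia).
exists y => //; apply: le_trans yv _.
have := cr (tree m fp false 1 - N) g ltac:(lia) gN.
by rewrite subnKC //; lia.
Qed.

Lemma runs_next m q Q :
  m 2 = fp -> frame m q -> state m q -> 0 < q < 2 * N ->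
  (q < 2 * N - 1 -> forall m', calling m' q ->
     (forall x, 16 <= x < fp -> m' x = m x) -> Q m') ->
  (q = 2 * N - 1 -> forall m', m' 2 = p -> m' 3 = 1 -> m' 0 < n -> m' 1 < n ->
     block_saddle s r0 c0 (entry (m' 0) (m' 1)) ->
     (forall x, 16 <= x < fp -> m' x = m x) -> Q m') ->
  runs next m 10 Q.
Proof.
move=> m2 fr st qN post_call post_ret; apply: runs_bounded => // bm.
have [f0 f1 f2 f3 f4 f5 f6] := fr; have ns := groups_le; have n2 := groups_ge2.
apply: runs_if_le => //=; rewrite m2 f2 f5 => h.
  have qN' : (q < N) = false by lia.
  rewrite /state qN' in st.
  have qE : q = 2 * N - 1 by lia.
  have rN := full_root false st; have [k1 k2] := full_keys st false rN; rewrite /= in k1 k2.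
  have bs : full_state m (2 * N - 1) by rewrite -qE.
  have {}bs := full_saddle bs.
  have tE : m (fp + 8 * 1 + 0) = tree m fp false 1 by [].
  have pB := bm (fp + 6); rewrite f6 in pB.
  apply: (runs_weaken B64 BW (k := 5) (Q := Q)) => //.
  move: (tree m fp false 1) rN k1 k2 bs tE => X rN k1 k2 bs tE.
  have {}k1 : m (fp + 8 * X + 2) < n := k1.
  have {}k2 : m (fp + 8 * X + 3) < n := k2.
  apply: runs_store_seq => //=; rewrite ?m2 ?tE; try lia.
  apply: runs_store_seq => //=; look; rewrite ?m2; look; try lia.
  apply: runs_store_seq => //=; look; rewrite ?m2; look; try lia.
  apply: runs_store_seq => //=; look; try lia.
  apply: runs_store => //=; look; rewrite ?m2; look; rewrite ?f6 //.
  apply: post_ret => //; try (by look).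
  by move=> x xf; look.
apply: (runs_seq_le B64 BW (k1 := 3)) => //.
have call X Y m1 : X < N -> Y < N -> (forall b, next_group m b q = if b then Y else X) ->
    m1 7 = X -> m1 8 = Y -> (forall x, x <> 7 -> x <> 8 -> m1 x = m x) -> runs push m1 (9 - 3) Q.
  move=> XN YN XY m17 m18 m1E.
  have fr1 : frame m1 q by apply: frame_congr fr => x xf; apply: m1E; lia.
  apply: (@runs_push m1 X Y q) => //; first by rewrite m1E.
  move=> m' h1 h2 h3 h4 h5 h6 m'E.
  have m'E1 x : 16 <= x < fp + 16 * N -> m' x = m x by move=> xf; rewrite m'E ?m1E //; lia.
  have nE b : next_group m' b q = if b then Y else X.
    rewrite -XY /next_group /tree m'E1 //; case: (b) => /=; lia.
  apply: post_call; first lia.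
    split; rewrite ?nE //.
      by apply: frame_congr fr => x xf; apply: m'E1; lia.
    by apply: state_congr st => x xf; apply: m'E1; lia.
  by move=> x xf; apply: m'E1; lia.
apply: runs_if_le => //=; rewrite m2 f2 f5 => h'.
  apply: runs_store_seq => //=; rewrite ?m2 ?f5; try lia.
  apply: runs_store => //=; look; rewrite ?m2; look; rewrite ?f5; try lia.
  have qN' : q < N by lia.
  apply: (call q q); try lia; try (by look).
  - by move=> b; rewrite /next_group qN'; case: b.
  - by move=> x x7 x8; look.
have qN' : (q < N) = false by lia.
have rng b : N <= tree m fp b 1 < 2 * N.
  by move: st; rewrite /state qN'; apply: full_root.
have t0 : m (fp + 8 * 1 + 0) = tree m fp false 1 by [].
have t1 : m (fp + 8 * 1 + 1) = tree m fp true 1 by [].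
have r0N := rng false; have r1N := rng true.
apply: runs_store_seq => //=; rewrite ?m2 ?f2 ?t0; try lia.
apply: runs_store => //=; look; rewrite ?m2; look; rewrite ?f2 ?t1; try lia.
apply: (call (tree m fp false 1 - N) (tree m fp true 1 - N)); try lia; try (by look).
- by move=> b; rewrite /next_group qN'; case: b.
- by move=> x x7 x8; look.
Qed.

End Frame.

(** * The recursion *)

Section Correctness.

Variables (n0 : nat) (d : Order.disp_t) (T : orderType d) (A : 'M[T]_n0.+1).
Variables (B W : nat).
Hypotheses (B64 : 64 < B) (BW : B ^ 12 <= W) (nB : 32 * n0.+1 + 64 <= B).

Local Notation n := n0.+1.
Local Notation runs := (runs A B W).
Local Notation entry := (entry A).

(** Continuation style replaces procedure calls: if the loop finishes within [k] from any correct
    return, it finishes within [t + k] from the call. The space [32 * s] is enough, since a frame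
    takes [16 * N <= 16 * s] cells and its callee needs [32 * trunc_log 2 s <= 16 * s]. *)
Definition solves (s t : nat) : Prop :=
  forall fp r0 c0 p m k Q,
  r0 + s <= n -> c0 + s <= n -> 16 <= fp -> fp + 32 * s <= 16 + 32 * n ->
  m 2 = fp -> m 3 = 0 -> m (fp + 0) = s -> m (fp + 3) = r0 -> m (fp + 4) = c0 ->
  m (fp + 6) = p ->
  (forall m', m' 2 = p -> m' 3 = 1 -> m' 0 < n -> m' 1 < n ->
     block_saddle A s r0 c0 (entry (m' 0) (m' 1)) ->
     (forall x, 16 <= x < fp -> m' x = m x) -> runs loop m' k Q) ->
  runs loop m (t + k) Q.

Lemma solves1 : solves 1 7.
Proof.
move=> fp r0 c0 p m k Q r0s c0s fp16 fpn m2 m3 ms mr mc mp post.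
apply: runs_bounded => // bm; have pB := bm (fp + 6); rewrite mp in pB.
rewrite (_ : 7 + k = (6 + k).+1) //.
apply: runs_while_true => //=; first by rewrite m2; lia.
apply: runs_if_le => //=; rewrite ?m3 // => _.
apply: runs_if_le => //=; rewrite ?m2 ?ms // => _.
apply: runs_store_seq => //=; rewrite ?m2 ?mr; try lia.
apply: runs_store_seq => //=; look; rewrite ?m2; look; rewrite ?mc; try lia.
apply: runs_store_seq => //=; look; try lia.
apply: runs_store => //=; look; rewrite ?m2; look; rewrite ?mp //.
apply: post; try (by look); try (look; lia).
  look; split=> x xs.
    by exists c0; [lia | rewrite (_ : x = r0) //; lia].
  by exists r0; [lia | rewrite (_ : x = c0) //; lia].
by move=> x xf; look.
Qed.

Lemma solves_step s t : 1 < s -> solves (trunc_log 2 s) t ->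
  solves s ((2 * ngroups s (trunc_log 2 s) - 1) * t + 200 * s).
Proof.
move=> s1 IH fp r0 c0 p m k Q r0s c0s fp16 fpn m2 m3 ms mr mc mp post.
have mh := trunc_log2_half s1; have m0 := trunc_log2_gt0 s1.
have n2 := ngroups_ge2 s1; have ns := ngroups_le s1.
have nm := ngroups_mul s m0.
have gr g : group_start s (trunc_log 2 s) g + trunc_log 2 s <= s by apply: group_start_le; lia.
(* One call with its absorption and the choice of what follows; [R] is the budget left
   afterwards. *)
have call q m' R : q < 2 * ngroups s (trunc_log 2 s) - 1 ->
    calling A fp s r0 c0 p m' q -> (forall x, 16 <= x < fp -> m' x = m x) ->
    (q.+1 < 2 * ngroups s (trunc_log 2 s) - 1 -> forall m'', calling A fp s r0 c0 p m'' q.+1 ->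
       (forall x, 16 <= x < fp -> m'' x = m x) -> runs loop m'' R Q) ->
    (q.+1 = 2 * ngroups s (trunc_log 2 s) - 1 -> k <= R) ->
    runs loop m' (t + ((12 * trunc_log 2 s + 26 + (q.+1 == ngroups s (trunc_log 2 s)) *
           (10 * ngroups s (trunc_log 2 s)) + 10).+1 + R).+1) Q.
  move=> qN [h2 h3 hs hr hc hp fr st] m'E more last.
  have g0 := gr (next_group fp s m' false q); have g1 := gr (next_group fp s m' true q).
  apply: (IH _ _ _ fp m' _ Q _ _ _ _ h2 h3 hs hr hc hp); try lia.
  move=> m1 m12 m13 m10 m11 bs m1E.
  have fr1 : frame fp s r0 c0 p m1 q by apply: (frame_congr B64 BW nB s1 r0s c0s fp16 fpn _ fr) => x xf; apply: m1E; lia.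
  have st1 : state A fp s r0 c0 m1 q.
    by apply: (state_congr B64 BW nB s1 r0s c0s fp16 fpn _ st) => x xf; apply: m1E; lia.
  have nE b : next_group fp s m1 b q = next_group fp s m' b q.
    by rewrite /next_group /tree m1E //; case: (b) => /=; lia.
  rewrite -!nE in bs.
  apply: runs_while_true => //=; first by rewrite m12; lia.
  apply: runs_if_le => //=; rewrite m13 // => _.
  apply: runs_seq => //.
  apply: (runs_absorb B64 BW nB s1 r0s c0s fp16 fpn m12 fr1 st1 qN m10 m11 bs).
  move=> m2' m22 fr2 st2 m2E.
  have m2E' x : 16 <= x < fp -> m2' x = m x.
    by move=> xf; rewrite m2E // m1E ?m'E //; lia.
  apply: (runs_next B64 BW nB s1 r0s c0s fp16 fpn m22 fr2 st2); first lia.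
    move=> qN' m3' ca m3E; apply: more => // x xf.
    by rewrite m3E // m2E'.
  move=> qN' m3' m32 m33 m30 m31 bs' m3E.
  apply: (runs_weaken B64 BW (k := k) (Q := Q)) => //; first exact: last.
  apply: post => // x xf.
  by rewrite m3E // m2E'.
(* [j.+1] calls remain. The term with [q < ngroups] is the cost of building the trees, still to be
   paid during the diagonal phase. *)
have step j q m' : q + j.+1 = 2 * ngroups s (trunc_log 2 s) - 1 ->
    calling A fp s r0 c0 p m' q -> (forall x, 16 <= x < fp -> m' x = m x) ->
    runs loop m' (j.+1 * (t + 12 * trunc_log 2 s + 40) +
      (q < ngroups s (trunc_log 2 s)) * (10 * ngroups s (trunc_log 2 s)) + k) Q.
  elim: j q m' => [|j IHj] q m' qj ca m'E.
    apply: (runs_weaken B64 BW (Q := Q) _ _ (call q m' k _ ca m'E _ _)) => //; try lia.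
  have {}IHj := IHj q.+1 _ ltac:(lia).
  apply: (runs_weaken B64 BW (Q := Q) _ _ (call q m' _ _ ca m'E (fun _ => IHj) _)) => //; try lia.
apply: runs_bounded => // bm; have pB := bm (fp + 6); rewrite mp in pB.
have time_le : ((3 * trunc_log 2 s + 13).+2 + ((2 * ngroups s (trunc_log 2 s) - 1) *
    (t + 12 * trunc_log 2 s + 40) + 1 * (10 * ngroups s (trunc_log 2 s)) + k)).+1 <=
    (2 * ngroups s (trunc_log 2 s) - 1) * t + 200 * s + k.
  (* Climbing costs [O(m)] in each of [2 * N - 1] calls, hence [O(s)] in all because
     [(2 * N - 1) * m <= 2 * s + m]. *)
  rewrite -(addnA t) mulnDr.
  have : (2 * ngroups s (trunc_log 2 s) - 1) * (12 * trunc_log 2 s + 40) <=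
    12 * (2 * s + trunc_log 2 s) + 80 * s.
    rewrite mulnDr; apply: leq_add; last lia.
    by rewrite mulnCA leq_mul // mulnBl; lia.
  lia.
apply: (runs_weaken B64 BW (Q := Q) time_le) => //.
apply: runs_while_true => //=; first by rewrite m2; lia.
apply: runs_if_le => //=; rewrite ?m3 // => _.
apply: runs_if_le => //=; rewrite ?m2 ?ms => h; first lia.
apply: (runs_enter A B64 BW nB s1 r0s c0s fp16 fpn m2 ms mr mc mp).
move=> m' h1 h2 h3 h4 h5 h6 fr m'E.
have N0 : 0 < ngroups s (trunc_log 2 s) by lia.
have := step (2 * ngroups s (trunc_log 2 s) - 2) 0 m' ltac:(lia) _ m'E.
rewrite N0 (_ : (2 * ngroups s (trunc_log 2 s) - 2).+1 = 2 * ngroups s (trunc_log 2 s) - 1); last lia.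
apply; split=> //.
- by rewrite /next_group N0.
- by rewrite /next_group N0.
- by rewrite /state N0.
Qed.

(** The fuel suffices since the logarithm of a size above 1 is smaller than the size. *)
Lemma solves_cost f s : 0 < s -> s <= f -> solves s (cost 200 f s).
Proof.
elim: f s => [|f IH] s s0 sf; first lia.
rewrite /=; case: (leqP s 1) => s1.
  have -> : s = 1 by lia.
  move=> fp r0 c0 p m k Q *; apply: (runs_weaken B64 BW (k := 7 + k) (Q := Q)) => //; first lia.
  by apply: (@solves1 fp r0 c0 p).
apply: solves_step => //; apply: IH; first exact: trunc_log2_gt0.
by have := trunc_log2_half s1; lia.
Qed.

Lemma program_runs :
  runs program (init_memory n) (cost 200 n n + 3)
    (fun m' => [/\ m' 0 < n, m' 1 < n & block_saddle A n 0 0 (entry (m' 0) (m' 1))]).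
Proof.
rewrite (_ : cost 200 n n + 3 = 1 + (1 + (cost 200 n n + 1))); last lia.
apply: runs_seq => //; apply: runs_store => //=; first by rewrite /init_memory /=; lia.
apply: runs_seq => //; apply: runs_store => //=; first lia.
set m1 := upd _ 2 _.
have m1E x : x <> 2 -> x <> 16 -> m1 x = init_memory n x by move=> x2 x16; rewrite /m1; look.
apply: (@solves_cost n n _ _ 16 0 0 0) => //; try (by rewrite m1E); try (by rewrite /m1; look).
move=> m' m'2 m'3 m'0 m'1 bs _.
by apply: runs_while_false => //=; rewrite m'2.
Qed.

End Correctness.

(** * Word size and the final bound *)

Lemma word_size n : 0 < n -> (32 * n + 64) ^ 12 <= (n + 2) ^ (5 * 12).
Proof.
move=> n_gt0; rewrite expnM leq_exp2r // (_ : 32 * n + 64 = (n + 2) * 32); last lia.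
(* [32 <= 3 ^ 4], so that [32 * (n + 2) <= (n + 2) ^ 5]. *)
have : 3 ^ 4 <= (n + 2) ^ 4 by rewrite leq_exp2r //; lia.
by rewrite (expnS _ 4) leq_mul2l => n4; rewrite (leq_trans _ n4) ?orbT.
Qed.

(* Words have k * log_2 (n + 2) bits, for a constant k. *)
Theorem theorem11 :
  exists (c : cmd) (k C : nat),
  forall (n : nat) (d : Order.disp_t) (T : orderType d) (A : 'M[T]_n),
    0 < n ->
    reports_pseudo_saddlepoint ((n + 2) ^ k) c A (C * (n * 2 ^ lgstar (INR n))).
Proof.
have [D costD] := cost_log_star.
(* The factor 2 comes from [2 * 2 ^ ilog - 1]; the 3 units outside the recursion are two stores and
   the last test of the loop. *)
exists program, (5 * 12), (2 * (3 * 200 * D) + 3) => -[//|n] d T A _.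
have B64 : 64 < 32 * n.+1 + 64 by lia.
have lt0 : words_lt (32 * n.+1 + 64) (init_memory n.+1).
  by move=> x; rewrite /init_memory; case: ifP => _; lia.
have [m [t [ex tle _ [m0 m1 [rows cols]]]]] := program_runs A B64 (word_size (ltn0Sn n)) (leqnn _) lt0.
exists m, t, (inord (m 0)), (inord (m 1)); split=> //; rewrite ?inordK //.
  apply: leq_trans tle _.
  have := costD 200 n.+1 n.+1 (ltn0Sn n).
  have : 2 ^ ilog n.+1 n.+1 <= 2 ^ lgstar (INR n.+1).
    by rewrite leq_exp2l //; apply: ilog_lgstar; apply: Rle_refl.
  have : 0 < 2 ^ lgstar (INR n.+1) by rewrite expn_gt0.
  move: (cost _ _ _) (2 ^ ilog _ _) (2 ^ lgstar _) (3 * 200 * D) => c x y K y0 xy cK.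
  nia.
split=> i.
  have [y yn vy] := rows i (ltn_ord i).
  by exists (inord y); move: vy; rewrite /entry inord_val.
have [x xn vx] := cols i (ltn_ord i).
by exists (inord x); move: vx; rewrite /entry inord_val.
Qed.
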